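(* Let $G_n=(V_n,E_n)$, $n\in\mathbb{N}$, be finite digraphs with $\lim_{n\to\infty}|V_n|=\infty$. Suppose that for every finite rooted tree $G'=(V',E')$ the limit \[ \beta_{G'}:=\lim_{n\to\infty}\frac{|\mathrm{Hom}(G',G_n)|}{|V_n|^{|V'|}} \] exists. Let $\mu\in\mathcal{P}(\mathbb{R})$ and let $(\mu_n)_{n\in\mathbb{N}}$ be probability measures on $\mathbb{R}$ such that $\mu_n^{\uplus|V_n|}\to\mu$ weakly. Then $\lim_{n\to\infty}\boxplus_{G_n}(\mu_n)$ exists (weakly) in $\mathcal{P}(\mathbb{R})$. Furthermore, this limit depends only on $\mu$ and on the coefficients $\beta_{G'}$ ($G'$ ranging over finite rooted trees): if $(\tilde G_n,\tilde\mu_n)$ is another pair of sequences satisfying the same hypotheses with the same $\mu$ and the same coefficients $\beta_{G'}$ for all finite rooted trees $G'$, then $\lim_n\boxplus_{\tilde G_n}(\tilde\mu_n)=\lim_n\boxplus_{G_n}(\mu_n)$.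
   Context: A digraph is a pair $G=(V,E)$ with $E\subseteq V\times V$ disjoint from the diagonal; write $v\rightsquigarrow w$ if $(v,w)\in E$. A digraph homomorphism $G_1\to G_2$ is a map $\phi:V_1\to V_2$ with $v\rightsquigarrow w\Rightarrow \phi(v)\rightsquigarrow\phi(w)$; $\mathrm{Hom}(G_1,G_2)$ is the set of these. A rooted tree is a digraph with a vertex $r$ (the root) such that every vertex $w$ is reached by a unique directed path from $r$. $\mathcal{P}(\mathbb{R})$ is the space of Borel probability measures on $\mathbb{R}$ with the weak-$*$ topology. For $\mu\in\mathcal{P}(\mathbb{R})$ and $z$ in the upper half-plane $\mathbb{C}^+$, let $G_\mu(z)=\int\frac{1}{z-t}\,d\mu(t)$ and $K_\mu(z)=z-1/G_\mu(z)$. The boolean convolution $\mu\uplus\nu$ is the probability measure with $K_{\mu\uplus\nu}=K_\mu+K_\nu$, and for $t>0$ the boolean power $\mu^{\uplus t}$ is the (known to exist, unique) probability measure with $K_{\mu^{\uplus t}}=tK_\mu$. For a finite digraph $G=(V,E)$ and $(\mu_v)_{v\in V}\subseteq\mathcal{P}(\mathbb{R})$ there is a unique family $(\nu_v)_{v\in V}\subseteq\mathcal{P}(\mathbb{R})$ with $K_{\nu_v}(z)=K_{\mu_v}\big(z-\sum_{w:\,v\rightsquigarrow w}K_{\nu_w}(z)\big)$ for $z\in\mathbb{C}^+$; the $G$-free convolution is $\boxplus_G((\mu_v)_v)=\biguplus_{v\in V}\nu_v$, and $\boxplus_G(\mu)$ denotes the case where all $\mu_v=\mu$. (For compactly supported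 measures this agrees with the distribution of a sum of $G$-freely independent variables with distributions $\mu_v$.) *)

(* Defs.v *)
From HB Require Import structures.
From mathcomp Require Import all_boot all_order all_algebra.
From mathcomp Require Import all_classical all_reals all_analysis.
From mathcomp Require complex.
Import complex.ComplexField.

Set Implicit Arguments.
Unset Strict Implicit.
Unset Printing Implicit Defensive.

Import Order.TTheory GRing.Theory Num.Theory.
Import numFieldNormedType.Exports.
Local Open Scope ring_scope.
Local Open Scope classical_set_scope.

Definition digraph (T : finType) (e : rel T) : Prop := forall v, ~~ e v v.

Definition rooted_tree (T : finType) (e : rel T) (r : T) : Prop :=
  digraph e /\
  forall w : T, exists! p : seq T, path e r p /\ last r p = w.

Definition homs (T : finType) (e : rel T) (V : finType) (E : rel V)
  : {set {ffun T -> V}} :=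
  [set f : {ffun T -> V} | [forall x, forall y, e x y ==> E (f x) (f y)]].

Definition hom_density (R : realType) (T : finType) (e : rel T)
  (V : finType) (E : rel V) : R :=
  (#|homs e E|)%:R / ((#|V|)%:R ^+ #|T|).

Notation prob R := (probability R R).

Definition weak_cvg (R : realType) (mus : nat -> prob R) (mu : prob R) : Prop :=
  forall f : R -> R, continuous f -> (exists M : R, forall x, `|f x| <= M) ->
    (fun n => Rintegral (mus n) setT f) @ \oo --> Rintegral mu setT f.

Notation C R := (complex.complex R).

(* G_mu(z) = int 1/(z - t) dmu(t), written via its real and imaginary parts:
   1/(z-t) = ((x-t) - i y) / ((x-t)^2 + y^2) for z = x + i y. *)
Definition cauchy (R : realType) (mu : prob R) (z : C R) : C R :=
  let x := complex.Re z in let y := complex.Im z in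
  @complex.Complex R
    (Rintegral mu setT (fun t => (x - t) / ((x - t) ^+ 2 + y ^+ 2)))
    (Rintegral mu setT (fun t => - y / ((x - t) ^+ 2 + y ^+ 2))).

Definition Ktrans (R : realType) (mu : prob R) (z : C R) : C R :=
  z - (cauchy mu z)^-1.

Definition upper (R : realType) (z : C R) : Prop := 0 < complex.Im z.

Definition is_boolean_power (R : realType) (mu : prob R) (t : nat) (nu : prob R)
  : Prop :=
  forall z : C R, upper z -> Ktrans nu z = t%:R * Ktrans mu z.

(* lam is the G-free convolution of (mus v)_v: there is a family (nus v)_v with
   K_{nu_v}(z) = K_{mu_v}(z - sum_{w : v ~> w} K_{nu_w}(z)) on C^+, and
   lam = biguplus_v nu_v, i.e. K_lam = sum_v K_{nu_v} on C^+. *)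
Definition is_Gfree_conv (R : realType) (V : finType) (E : rel V)
  (mus : V -> prob R) (lam : prob R) : Prop :=
  exists nus : V -> prob R,
    (forall (v : V) (z : C R), upper z ->
       Ktrans (nus v) z = Ktrans (mus v) (z - \sum_(w | E v w) Ktrans (nus w) z))
    /\ (forall z : C R, upper z -> Ktrans lam z = \sum_(v : V) Ktrans (nus v) z).

(* Main.v *)
(* Put N = |V_n|, let k_n be the K-transform of the boolean power of mu_n of
   order N, and g_v = N K_{nu_v}.  The defining equations read
   g_v(z) = k_n(z - N^-1 sum_{w : v ~> w} g_w(z)), and the convolution has
   K-transform N^-1 sum_v g_v.  At z = iy with y large, weak convergence of the
   boolean powers makes k_n small compared with y and 1/2-Lipschitz on a disc
   of radius y/4 around iy, uniformly in n.  A continuity argument in y,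
   starting from y = oo, keeps the solution g of size at most y/8, so that g is
   a uniform limit of the fixed-point iterates.  Expanding k_n in powers, with
   convergent coefficients, every iterate is uniformly approximated by a fixed
   linear combination of the functions sending v to the number of homomorphisms
   of a rooted tree T with root at v, divided by N^(|T|-1); the averages of
   these are the densities of the theorem.  Hence the K-transforms of the
   convolutions converge at iy for y large, and are o(y) uniformly in n.
   By partial fractions, the functions 1/(t^2+a) and t/(t^2+a), a large, span
   modulo constants and uniform limits an algebra, which is closed under
   absolute values; up to tails it contains all piecewise linear ramps.  So the
   integrals of ramps converge, and their limits give the distribution function
   of the limit measure.  The limit depends only on the stated data because two
   admissible sequences can be interleaved into a single one. *)
From HB Require Import structures.
From mathcomp Require Import all_boot all_order all_algebra.
From mathcomp Require Import all_classical all_reals all_analysis.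
From mathcomp Require Import measurable_realfun zify ring lra.
From mathcomp Require Import complex.
Require Import Defs.
Import complex.ComplexField complex.ComplexField.Normc.

Set Implicit Arguments.
Unset Strict Implicit.
Unset Printing Implicit Defensive.

Import Order.TTheory GRing.Theory Num.Theory.
Import numFieldNormedType.Exports.
Local Open Scope ring_scope.
Local Open Scope classical_set_scope.

Local Notation Re := complex.Re.
Local Notation Im := complex.Im.

(** * Bounded measurable integrands, complex-valued integrals *)

Section BoundedMeasurable.
Variable R : realType.
Implicit Types (rho : prob R) (f g h : R -> R).

(** The measures [nu v] come with the convolution and carry no bound uniform in n, and the
    fixed-point equation alone does not exclude a large solution, at which the K-transform of the
    boolean power is out of control. What helps is that smallness improves itself: a crude bound on
    the mean of the |g_v| puts all arguments into the disc, where a much better bound holds. For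
    each single n the crude bound holds far out on the axis; this starting point depends on n, but
    the threshold down to which the bound propagates does not. On the imaginary axis the propagation
    is a one-variable intermediate value argument, and neither analytic continuation nor an
    inversion formula is called for: the values there amount to real integrals of 1/(t^2+y^2) and
    t/(t^2+y^2), from which the limit measure is rebuilt. No moments are assumed, so expansions are
    centred at iy rather than at infinity, with bounded continuous functions under the integral. One
    quantity, [etheta], bounds both the K-transform and its Lipschitz constant. Limits arise from
    the Cauchy criterion and are never computed, which is why two sequences are compared by
    interleaving them. *)

Definition bmf f := measurable_fun setT f /\ exists M, forall x, `|f x| <= M.

Lemma bmf_continuous f M : continuous f -> (forall x, `|f x| <= M) -> bmf f.
Proof.
by move=> cf fM; split; [exact: continuous_measurable_fun|exists M].
Qed.

Lemma bmf_cst (c : R) : bmf (fun=> c).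
Proof. by split; [exact: measurable_cst|exists `|c|]. Qed.

Lemma bmfD f g : bmf f -> bmf g -> bmf (fun x => f x + g x).
Proof.
move=> [mf [M fM]] [mg [N gN]]; split; first exact: measurable_funD.
by exists (M + N) => x; rewrite (le_trans (ler_normD _ _))// lerD.
Qed.

Lemma bmfM f g : bmf f -> bmf g -> bmf (fun x => f x * g x).
Proof.
move=> [mf [M fM]] [mg [N gN]]; split; first exact: measurable_funM.
by exists (M * N) => x; rewrite normrM ler_pM.
Qed.

Lemma bmfZ (c : R) f : bmf f -> bmf (fun x => c * f x).
Proof. by move=> bf; apply: bmfM => //; exact: bmf_cst. Qed.

Lemma bmfN f : bmf f -> bmf (fun x => - f x).
Proof.
by move=> /(bmfZ (-1)); congr bmf; apply/funext => x; rewrite mulN1r.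
Qed.

Lemma bmfB f g : bmf f -> bmf g -> bmf (fun x => f x - g x).
Proof. by move=> bf /bmfN; exact: bmfD. Qed.

Lemma bmf_norm f : bmf f -> bmf (fun x => `|f x|).
Proof.
move=> [mf [M fM]]; split; first exact: measurableT_comp.
by exists M => x; rewrite normr_id.
Qed.

Lemma bmf_integrable rho f : bmf f -> rho.-integrable setT (EFin \o f).
Proof.
move=> [mf [M fM]]; apply: (@le_integrable _ _ _ _ _ _ _ (EFin \o cst M)) => //.
- exact/measurable_EFinP.
- by move=> x _ /=; rewrite lee_fin (le_trans (fM x)) ?ler_norm.
- exact: finite_measure_integrable_cst.
Qed.

Lemma intD rho f g : bmf f -> bmf g ->
  Rintegral rho setT (fun x => f x + g x) =
  Rintegral rho setT f + Rintegral rho setT g.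
Proof. by move=> bf bg; rewrite RintegralD//; exact: bmf_integrable. Qed.

Lemma intB rho f g : bmf f -> bmf g ->
  Rintegral rho setT (fun x => f x - g x) =
  Rintegral rho setT f - Rintegral rho setT g.
Proof. by move=> bf bg; rewrite RintegralB//; exact: bmf_integrable. Qed.

Lemma intZ rho (c : R) f : bmf f ->
  Rintegral rho setT (fun x => c * f x) = c * Rintegral rho setT f.
Proof. by move=> bf; rewrite RintegralZl//; exact: bmf_integrable. Qed.

Lemma int_cst rho (c : R) : Rintegral rho setT (fun=> c) = c.
Proof. by rewrite Rintegral_cst// [X in fine X](probability_setT rho) mulr1. Qed.

Lemma le_int rho f g : bmf f -> bmf g -> (forall x, f x <= g x) ->
  Rintegral rho setT f <= Rintegral rho setT g.
Proof. by move=> bf bg fg; apply: le_Rintegral => //; exact: bmf_integrable. Qed.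

Lemma norm_int rho f h : bmf f -> bmf h -> (forall x, `|f x| <= h x) ->
  `|Rintegral rho setT f| <= Rintegral rho setT h.
Proof.
move=> bf bh fh.
apply: le_trans (le_normr_Rintegral _ (bmf_integrable rho bf)) _ => //.
by apply: le_int => //; exact: bmf_norm.
Qed.

Lemma norm_intB rho f g h : bmf f -> bmf g -> bmf h ->
  (forall x, `|f x - g x| <= h x) ->
  `|Rintegral rho setT f - Rintegral rho setT g| <= Rintegral rho setT h.
Proof.
by move=> bf bg bh fgh; rewrite -intB//; apply: norm_int => //; exact: bmfB.
Qed.

End BoundedMeasurable.

Section Complex.
Variable R : realType.
Implicit Types (rho : prob R) (z w : C R) (q r : R -> C R).
Local Notation toC := (complex.real_complex R).

Lemma normcE z : normc z = Num.sqrt (Re z ^+ 2 + Im z ^+ 2).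
Proof. by case: z. Qed.

Lemma normc_ge0 z : 0 <= normc z.
Proof. by rewrite normcE sqrtr_ge0. Qed.

Lemma le_normc_Re z : `|Re z| <= normc z.
Proof. by rewrite normcE -sqrtr_sqr ler_wsqrtr// lerDl sqr_ge0. Qed.

Lemma le_normc_Im z : `|Im z| <= normc z.
Proof. by rewrite normcE -sqrtr_sqr ler_wsqrtr// lerDr sqr_ge0. Qed.

Lemma normc_le_ReIm z : normc z <= `|Re z| + `|Im z|.
Proof.
rewrite normcE -[leRHS]ger0_norm ?addr_ge0// -sqrtr_sqr ler_wsqrtr//.
by rewrite sqrrD !real_normK ?num_real// lerD2r lerDl mulrn_wge0// mulr_ge0.
Qed.

Lemma le_normcB z w : normc (z - w) <= normc z + normc w.
Proof. by rewrite (le_trans (complex.le_normcD _ _))// complex.normcN. Qed.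

Lemma normc_distC z w : normc (z - w) = normc (w - z).
Proof. by rewrite -complex.normcN opprB. Qed.

Lemma le_normc_dist z w : normc z - normc w <= normc (z - w).
Proof. by rewrite lerBlDr -{1}(subrK w z) complex.le_normcD. Qed.

Lemma le_normc_distD z1 z2 z3 :
  normc (z1 - z3) <= normc (z1 - z2) + normc (z2 - z3).
Proof.
have -> : z1 - z3 = (z1 - z2) + (z2 - z3) by rewrite addrA subrK.
exact: complex.le_normcD.
Qed.

Lemma normc_toC (x : R) : normc (toC x) = `|x|.
Proof. by rewrite /= expr0n /= addr0 sqrtr_sqr. Qed.

Lemma normcX z n : normc (z ^+ n) = normc z ^+ n.
Proof.
elim: n => [|n IH]; first by rewrite !expr0 normc1.
by rewrite !exprS normcM IH.
Qed.

Lemma normc_gt0 z : (0 < normc z) = (z != 0).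
Proof.
rewrite lt_def normc_ge0 andbT; congr negb; apply/eqP/eqP => [/eq0_normc//|->].
by rewrite normc0.
Qed.

Lemma le_normc_sum (I : Type) (r : seq I) (P : pred I) (F : I -> C R) :
  normc (\sum_(i <- r | P i) F i) <= \sum_(i <- r | P i) normc (F i).
Proof.
elim/big_rec2: _ => [|i y x _ le]; first by rewrite normc0.
by rewrite (le_trans (complex.le_normcD _ _))// lerD2l.
Qed.

Lemma normc_nat n : normc (n%:R : C R) = n%:R.
Proof.
have -> : (n%:R : C R) = toC n%:R by rewrite rmorph_nat.
by rewrite normc_toC ger0_norm.
Qed.

Definition ccont q := continuous (fun t => Re (q t)) /\ continuous (fun t => Im (q t)).

Definition cbd q := exists M, forall t, normc (q t) <= M.

Lemma ccont_cst z : ccont (fun=> z).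
Proof. by split=> t; exact: cvg_cst. Qed.

Lemma ccont_id : ccont toC.
Proof. by split=> t; [exact: cvg_id|exact: cvg_cst]. Qed.

Lemma ccontD q r : ccont q -> ccont r -> ccont (fun t => q t + r t).
Proof.
move=> [q1 q2] [r1 r2]; split=> t.
  have -> : (fun t => Re (q t + r t)) = (fun t => Re (q t) + Re (r t)).
    by apply/funext => u; case: (q u); case: (r u).
  by apply: cvgD; [exact: q1|exact: r1].
have -> : (fun t => Im (q t + r t)) = (fun t => Im (q t) + Im (r t)).
  by apply/funext => u; case: (q u); case: (r u).
by apply: cvgD; [exact: q2|exact: r2].
Qed.

Lemma ccontN q : ccont q -> ccont (fun t => - q t).
Proof.
move=> [q1 q2]; split=> t.
  have -> : (fun t => Re (- q t)) = (fun t => - Re (q t)).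
    by apply/funext => u; case: (q u).
  by apply: cvgN; exact: q1.
have -> : (fun t => Im (- q t)) = (fun t => - Im (q t)).
  by apply/funext => u; case: (q u).
by apply: cvgN; exact: q2.
Qed.

Lemma ccontM q r : ccont q -> ccont r -> ccont (fun t => q t * r t).
Proof.
move=> [q1 q2] [r1 r2]; split=> t.
  have -> : (fun t => Re (q t * r t)) =
            (fun t => Re (q t) * Re (r t) - Im (q t) * Im (r t)).
    by apply/funext => u; case: (q u); case: (r u).
  by apply: cvgB; apply: cvgM; [exact: q1|exact: r1|exact: q2|exact: r2].
have -> : (fun t => Im (q t * r t)) =
          (fun t => Re (q t) * Im (r t) + Im (q t) * Re (r t)).
  by apply/funext => u; case: (q u); case: (r u).
by apply: cvgD; apply: cvgM; [exact: q1|exact: r2|exact: q2|exact: r1].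
Qed.

Lemma ReV z : Re z^-1 = Re z / (Re z ^+ 2 + Im z ^+ 2).
Proof. by case: z. Qed.

Lemma ImV z : Im z^-1 = - Im z / (Re z ^+ 2 + Im z ^+ 2).
Proof. by case: z => a b; rewrite mulNr. Qed.

Lemma ReIm2_eq0 z : (Re z ^+ 2 + Im z ^+ 2 == 0) = (z == 0).
Proof.
by rewrite complex.eq_complex paddr_eq0 ?sqr_ge0// !sqrf_eq0.
Qed.

Lemma ccontV q : ccont q -> (forall t, q t != 0) -> ccont (fun t => (q t)^-1).
Proof.
move=> [q1 q2] q0.
have cN t : {for t, continuous (fun t => (Re (q t) ^+ 2 + Im (q t) ^+ 2)^-1)}.
  apply: cvgV; first by rewrite ReIm2_eq0.
  by apply: cvgD; apply: (cvgM _ _); [exact: q1|exact: q1|exact: q2|exact: q2].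
split=> t.
  under eq_fun do rewrite ReV.
  by apply: cvgM; [exact: q1|exact: cN].
under eq_fun do rewrite ImV.
by apply: cvgM; [apply: cvgN; exact: q2|exact: cN].
Qed.

Lemma cbd_cst z : cbd (fun=> z).
Proof. by exists (normc z). Qed.

Lemma cbdD q r : cbd q -> cbd r -> cbd (fun t => q t + r t).
Proof.
move=> [M qM] [N rN]; exists (M + N) => t.
by rewrite (le_trans (complex.le_normcD _ _))// lerD.
Qed.

Lemma cbdM q r : cbd q -> cbd r -> cbd (fun t => q t * r t).
Proof.
move=> [M qM] [N rN]; exists (M * N) => t.
by rewrite normcM ler_pM// normc_ge0.
Qed.

Lemma bmf_Re q : ccont q -> cbd q -> bmf (fun t => Re (q t)).
Proof.
move=> [c _] [M qM]; apply: (bmf_continuous (M := M)) => // t.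
exact: le_trans (le_normc_Re _) (qM t).
Qed.

Lemma bmf_Im q : ccont q -> cbd q -> bmf (fun t => Im (q t)).
Proof.
move=> [_ c] [M qM]; apply: (bmf_continuous (M := M)) => // t.
exact: le_trans (le_normc_Im _) (qM t).
Qed.

Definition cint rho q : C R :=
  complex.Complex (Rintegral rho setT (fun t => Re (q t)))
                  (Rintegral rho setT (fun t => Im (q t))).

Lemma cint_cst rho z : cint rho (fun=> z) = z.
Proof. by rewrite /cint !int_cst; case: z. Qed.

Lemma cintD rho q r : ccont q -> cbd q -> ccont r -> cbd r ->
  cint rho (fun t => q t + r t) = cint rho q + cint rho r.
Proof.
move=> cq bq cr br; rewrite /cint.
rewrite -[RHS]/(complex.Complex (_ + _) (_ + _)).
congr complex.Complex.
  by rewrite -intD; [|exact: bmf_Re..]; congr Rintegral; apply/funext => u;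
    case: (q u); case: (r u).
by rewrite -intD; [|exact: bmf_Im..]; congr Rintegral; apply/funext => u;
  case: (q u); case: (r u).
Qed.

Lemma cintZ rho z q : ccont q -> cbd q ->
  cint rho (fun t => z * q t) = z * cint rho q.
Proof.
move=> cq bq; rewrite /cint; case: z => a b.
rewrite -[RHS]/(complex.Complex (_ - _) (_ + _)).
have bR := bmf_Re cq bq; have bI := bmf_Im cq bq.
congr complex.Complex.
  rewrite -!intZ// -intB; [|exact: bmfZ..].
  by congr Rintegral; apply/funext => u; case: (q u).
rewrite -!intZ// -intD; [|exact: bmfZ..].
by congr Rintegral; apply/funext => u; case: (q u).
Qed.

Lemma cintB rho q r : ccont q -> cbd q -> ccont r -> cbd r ->
  cint rho (fun t => q t - r t) = cint rho q - cint rho r.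
Proof.
move=> cq bq cr br.
under [X in cint _ X]eq_fun do rewrite -mulN1r.
rewrite cintD//; first by rewrite cintZ// mulN1r.
- by apply: ccontM => //; exact: ccont_cst.
- by apply: cbdM => //; exact: cbd_cst.
Qed.

(** The factor 2 is the price of bounding real and imaginary parts separately; it enters all later
    constants. *)
Lemma normc_cint rho q (h : R -> R) : ccont q -> bmf h ->
  (forall t, normc (q t) <= h t) ->
  normc (cint rho q) <= 2 * Rintegral rho setT h.
Proof.
move=> cq bh qh.
have bq : cbd q.
  case: bh => _ [M hM]; exists M => t.
  by rewrite (le_trans (qh t))// (le_trans _ (hM t))// ler_norm.
rewrite (le_trans (normc_le_ReIm _))//= mulrDl mul1r lerD//.
  apply: norm_int => //; first exact: bmf_Re.
  by move=> t; rewrite (le_trans (le_normc_Re _)).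
apply: norm_int => //; first exact: bmf_Im.
by move=> t; rewrite (le_trans (le_normc_Im _)).
Qed.

End Complex.

(** * Cauchy transforms near the imaginary axis *)

Section Transforms.
Variable R : realType.
Implicit Types (rho : prob R) (z w s : C R) (y t : R).
Local Notation toC := (complex.real_complex R).
Local Notation iy y := (complex.Complex 0 y).

(* [etheta] controls at once the tail of [rho] and the K-transform near iy. *)
Definition theta y t := `|t| / (`|t| + y).

Definition etheta rho y := Rintegral rho setT (theta y).

Lemma theta_den y t : 0 < y -> 0 < `|t| + y.
Proof. by move=> y0; rewrite ltr_wpDl. Qed.

Lemma theta_ge0 y t : 0 < y -> 0 <= theta y t.
Proof. by move=> y0; rewrite divr_ge0// ltW// theta_den. Qed.

Lemma theta_le1 y t : 0 < y -> theta y t <= 1.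
Proof. by move=> y0; rewrite ler_pdivrMr ?theta_den// mul1r lerDl ltW. Qed.

Lemma continuous_theta y : 0 < y -> continuous (theta y).
Proof.
move=> y0 t; apply: cvgM; first exact: norm_continuous.
apply: cvgV; first by rewrite gt_eqF// theta_den.
by apply: cvgD; [exact: norm_continuous|exact: cvg_cst].
Qed.

Lemma norm_theta_le1 y t : 0 < y -> `|theta y t| <= 1.
Proof. by move=> y0; rewrite ger0_norm ?theta_ge0 ?theta_le1. Qed.

Lemma bmf_theta y : 0 < y -> bmf (theta y).
Proof.
move=> y0; apply: (bmf_continuous (M := 1)); first exact: continuous_theta.
by move=> t; exact: norm_theta_le1.
Qed.

Lemma etheta_ge0 rho y : 0 < y -> 0 <= etheta rho y.
Proof. by move=> y0; apply: Rintegral_ge0 => t _; exact: theta_ge0. Qed.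

Lemma etheta_nincr rho y y' : 0 < y -> y <= y' -> etheta rho y' <= etheta rho y.
Proof.
move=> y0 yy'; have y'0 := lt_le_trans y0 yy'.
apply: le_int; [exact: bmf_theta|exact: bmf_theta|move=> t].
by rewrite ler_wpM2l// lef_pV2 ?posrE ?theta_den// lerD2l.
Qed.

(** Dominated convergence along the integers, extended to real [y] by monotonicity. *)
Lemma etheta_cvg0 rho (e : R) : 0 < e ->
  exists2 M, 0 < M & forall y, M <= y -> etheta rho y <= e.
Proof.
move=> e0.
pose f (n : nat) t := (theta n.+1%:R t)%:E.
have n0 n : 0 < n.+1%:R :> R by [].
have : (fun n => \int[rho]_(t in setT) f n t)%E @ \oo -->
       (\int[rho]_(t in setT) cst 0 t)%E.
  apply: (@dominated_cvg _ _ _ _ _ _ _ _ (EFin \o cst 1)) => //.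
  - by move=> n; apply/measurable_EFinP; case: (bmf_theta (n0 n)).
  - move=> t _; apply: cvg_EFin; first by near=> n.
    rewrite /comp /=.
    apply: (@squeeze_cvgr _ _ _ _ (fun=> 0) (fun n => `|t| * n.+1%:R^-1)).
    + near=> n; rewrite theta_ge0//=.
      rewrite /theta ler_wpM2l// lef_pV2 ?posrE ?theta_den//.
      by rewrite lerDr.
    + exact: cvg_cst.
    + rewrite -[X in _ --> X](mulr0 `|t|); apply: cvgM; first exact: cvg_cst.
      exact: cvg_harmonic.
  - exact: finite_measure_integrable_cst.
  - by move=> n t _; rewrite /= lee_fin norm_theta_le1.
rewrite integral0 => /fine_cvgP[_] /cvgrPdist_le /(_ e e0)[N _ HN].
exists N.+1%:R => // y Ny.
apply: le_trans (etheta_nincr rho (n0 N) Ny) _.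
have := HN N (leqnn N); rewrite /= sub0r normrN; apply: le_trans.
by rewrite ler_norm.
Unshelve. all: by end_near. Qed.

Definition disc y z := 0 < y /\ normc (z - iy y) <= y / 4.

(** The point iy is at distance at least (|t| + y)/2 from t, the mean of |t| and y, and [z] is
    within y/4 of iy. *)
Lemma disc_dist y z t : disc y z -> (`|t| + y) / 4 <= normc (z - toC t).
Proof.
move=> [y0 zy].
have := le_normc_Re (iy y - toC t); have := le_normc_Im (iy y - toC t).
have -> : iy y - toC t = complex.Complex (- t) y.
  by rewrite /complex.real_complex_def; simpc.
rewrite /= normrN (gtr0_norm y0) => h1 h2.
have : normc (iy y - toC t) <= normc (iy y - z) + normc (z - toC t).
  exact: le_normc_distD.
have -> : iy y - toC t = complex.Complex (- t) y.
  by rewrite /complex.real_complex_def; simpc.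
rewrite normc_distC /=; move: h1 h2 zy; have := normr_ge0 t.
lra.
Qed.

Lemma disc_dist_gt0 y z t : disc y z -> 0 < normc (z - toC t).
Proof.
move=> dz; apply: lt_le_trans (disc_dist t dz).
by rewrite divr_gt0// theta_den//; case: dz.
Qed.

Lemma disc_neq y z t : disc y z -> z - toC t != 0.
Proof. by move=> dz; rewrite -normc_gt0 (disc_dist_gt0 _ dz). Qed.

Lemma disc_neq0 y z : disc y z -> z != 0.
Proof.
move=> dz; have := disc_neq 0 dz.
by rewrite (_ : toC 0 = 0) ?subr0.
Qed.

Lemma disc_norm y z : disc y z -> normc z <= 2 * y.
Proof.
move=> [y0 dz]; have := complex.le_normcD (z - iy y) (iy y).
rewrite subrK => /le_trans; apply.
have -> : normc (iy y) = y.
  by rewrite /= expr0n /= add0r sqrtr_sqr gtr0_norm.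
by move: dz; lra.
Qed.

Lemma disc_upper y z : disc y z -> 0 < Im z.
Proof.
move=> [y0 dz]; have := le_trans (le_normc_Im _) dz.
have -> : Im (z - iy y) = Im z - y by case: z {dz}.
by rewrite ler_norml; lra.
Qed.

Definition kern z t : C R := (z - toC t)^-1.

Lemma ccont_kern z : (forall t, z - toC t != 0) -> ccont (kern z).
Proof.
move=> z0; apply: ccontV => //.
by apply: ccontD; [exact: ccont_cst|apply: ccontN; exact: ccont_id].
Qed.

Lemma normc_kern y z t : disc y z -> normc (kern z t) <= 4 / (`|t| + y).
Proof.
move=> dz; have y0 := dz.1; rewrite /kern normcV.
rewrite -[leRHS]invrK lef_pV2 ?posrE ?(disc_dist_gt0 _ dz)//.
  by rewrite invf_div; exact: disc_dist.
by rewrite invf_div divr_gt0// theta_den.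
Qed.

Lemma normc_kern_le y z t : disc y z -> normc (kern z t) <= 4 / y.
Proof.
move=> dz; apply: le_trans (normc_kern t dz) _; have y0 := dz.1.
by rewrite ler_wpM2l// lef_pV2 ?posrE ?theta_den// lerDr.
Qed.

Lemma cbd_kern y z : disc y z -> cbd (kern z).
Proof. by move=> dz; exists (4 / y) => t; exact: normc_kern_le. Qed.

Lemma cauchyE rho z : cauchy rho z = cint rho (kern z).
Proof.
rewrite /cauchy /cint; congr complex.Complex; congr Rintegral; apply/funext => t.
  by rewrite /kern ReV; case: z => a b /=; rewrite subr0.
by rewrite /kern ImV; case: z => a b /=; rewrite subr0.
Qed.

Definition pker z t : C R := toC t * kern z t.

(** This is z G(z) - 1. It is small as soon as most of the mass of [rho] is close to 0 on the scale
    of z, without any moment of [rho]. *)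
Definition ptrans rho z := cint rho (pker z).

Lemma ccont_pker z : (forall t, z - toC t != 0) -> ccont (pker z).
Proof. by move=> z0; apply: ccontM; [exact: ccont_id|exact: ccont_kern]. Qed.

Lemma normc_pker y z t : disc y z -> normc (pker z t) <= 4 * theta y t.
Proof.
move=> dz; rewrite /pker normcM normc_toC /theta mulrCA.
by rewrite ler_wpM2l// normc_kern.
Qed.

Lemma cbd_pker y z : disc y z -> cbd (pker z).
Proof.
move=> dz; exists 4 => t; apply: le_trans (normc_pker t dz) _.
by have := theta_le1 t dz.1; lra.
Qed.

Lemma pkerE y z t : disc y z -> z * kern z t = 1 + pker z t.
Proof.
by move=> dz; rewrite /pker /kern; field; exact: disc_neq dz.
Qed.

Lemma cauchy_ptrans y rho z : disc y z -> z * cauchy rho z = 1 + ptrans rho z.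
Proof.
move=> dz; have z0 t := disc_neq t dz.
rewrite cauchyE -cintZ; [|exact: ccont_kern|exact: cbd_kern dz].
under [X in cint _ X]eq_fun do rewrite (pkerE _ dz).
rewrite cintD ?cint_cst//; [exact: ccont_cst|exact: cbd_cst|exact: ccont_pker|].
exact: cbd_pker dz.
Qed.

Lemma bmf_4theta y : 0 < y -> bmf (fun t => 4 * theta y t).
Proof. by move=> y0; apply: bmfZ; exact: bmf_theta. Qed.

Lemma normc_ptrans y rho z : disc y z -> normc (ptrans rho z) <= 8 * etheta rho y.
Proof.
move=> dz; have y0 := dz.1; have z0 t := disc_neq t dz.
apply: (le_trans (normc_cint rho (ccont_pker z0) (bmf_4theta y0) _)).
  by move=> t; exact: normc_pker.
by rewrite intZ ?mulrA -?natrM//; exact: bmf_theta.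
Qed.

Lemma pkerB y z w t : disc y z -> disc y w ->
  pker z t - pker w t = (w - z) * (pker z t * kern w t).
Proof.
move=> dz dw; rewrite /pker /kern.
have z0 := disc_neq t dz; have w0 := disc_neq t dw.
by field; apply/andP; split.
Qed.

(** The resolvent identity [pkerB] keeps the factor t of [pker], so the Lipschitz constant carries
    [etheta] and becomes small, not merely bounded. *)
Lemma ptrans_lip y rho z w : disc y z -> disc y w ->
  normc (ptrans rho z - ptrans rho w) <= 32 / y * etheta rho y * normc (z - w).
Proof.
move=> dz dw; have y0 := dz.1.
have z0 t := disc_neq t dz; have w0 t := disc_neq t dw.
rewrite -cintB; [|exact: ccont_pker|exact: cbd_pker dz|
                  exact: ccont_pker|exact: cbd_pker dw].
under [X in cint _ X]eq_fun do rewrite (pkerB _ dz dw).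
have cq : ccont (fun t => pker z t * kern w t).
  by apply: ccontM; [exact: ccont_pker|exact: ccont_kern].
have qb t : normc (pker z t * kern w t) <= 16 / y * theta y t.
  rewrite normcM.
  have -> : 16 / y * theta y t = (4 * theta y t) * (4 / y) by ring.
  by rewrite ler_pM ?normc_ge0 ?normc_kern_le// normc_pker.
rewrite cintZ//; last first.
  exists (16 / y) => t; apply: le_trans (qb t) _.
  by rewrite ler_piMr ?theta_le1 ?divr_ge0// ltW.
rewrite normcM normc_distC mulrC ler_wpM2r ?normc_ge0//.
apply: (le_trans (normc_cint rho cq (bmfZ (16 / y) (bmf_theta y0)) qb)).
rewrite intZ; last exact: bmf_theta.
by rewrite -/(etheta rho y) [leLHS](_ : _ = 32 / y * etheta rho y)//; ring.
Qed.

Section small.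
Variables (rho : prob R) (y : R).
Hypothesis small : etheta rho y <= 1 / 16.

(** The threshold 1/16 makes 8 [etheta] at most 1/2, which keeps 1 + [ptrans] away from 0. *)
Lemma normc_1ptrans z : disc y z -> 1 / 2 <= normc (1 + ptrans rho z).
Proof.
move=> dz; have := normc_ptrans rho dz.
have := le_normc_dist 1 (- ptrans rho z).
rewrite opprK complex.normcN normc1. move: small; lra.
Qed.

Lemma ptrans_neq0 z : disc y z -> 1 + ptrans rho z != 0.
Proof. by move=> dz; rewrite -normc_gt0; have := normc_1ptrans dz; lra. Qed.

Lemma KtransE z : disc y z ->
  Ktrans rho z = z * ptrans rho z / (1 + ptrans rho z).
Proof.
move=> dz; rewrite /Ktrans.
have z0 := disc_neq0 dz; have p0 := ptrans_neq0 dz.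
have -> : cauchy rho z = (1 + ptrans rho z) / z.
  by rewrite -(cauchy_ptrans rho dz) mulrAC divff// mul1r.
by field; apply/andP; split.
Qed.

Lemma normc_V1ptrans z : disc y z -> normc (1 + ptrans rho z)^-1 <= 2.
Proof.
move=> dz; have := normc_1ptrans dz => h.
rewrite normcV -[leRHS]invrK lef_pV2 ?posrE ?invr_gt0//; last by lra.
by rewrite -div1r.
Qed.

Lemma normc_Ktrans z : disc y z ->
  normc (Ktrans rho z) <= 32 * y * etheta rho y.
Proof.
move=> dz; rewrite KtransE// !normcM.
have -> : 32 * y * etheta rho y = (2 * y) * (8 * etheta rho y) * 2 by ring.
rewrite ler_pM ?mulr_ge0 ?normc_ge0 ?normc_V1ptrans//.
by rewrite ler_pM ?normc_ge0 ?disc_norm ?normc_ptrans.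
Qed.

Lemma Ktrans_lip z w : disc y z -> disc y w ->
  normc (Ktrans rho z - Ktrans rho w) <= 272 * etheta rho y * normc (z - w).
Proof.
move=> dz dw; have y0 := dz.1; rewrite !KtransE//.
have z0 := ptrans_neq0 dz; have w0 := ptrans_neq0 dw.
have -> : z * ptrans rho z / (1 + ptrans rho z)
    - w * ptrans rho w / (1 + ptrans rho w) =
    (z - w) * (ptrans rho z / (1 + ptrans rho z)) +
    w * (ptrans rho z - ptrans rho w) *
      ((1 + ptrans rho z)^-1 * (1 + ptrans rho w)^-1).
  by field; apply/andP; split.
apply: le_trans (complex.le_normcD _ _) _.
have e0 := etheta_ge0 rho y0.
(* 272 = 8 * 2 + 2 * 32 * (2 * 2): the change of the factor z, then the change of p/(1+p), whose
   difference is that of p divided by both denominators. *)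
have -> : 272 * etheta rho y * normc (z - w) =
  normc (z - w) * ((8 * etheta rho y) * 2) +
  (2 * y) * (32 / y * etheta rho y * normc (z - w)) * (2 * 2).
  by field; rewrite gt_eqF.
rewrite !normcM lerD//.
  rewrite ler_wpM2l ?normc_ge0// ler_pM ?normc_ge0 ?normc_V1ptrans//.
  exact: normc_ptrans.
rewrite ler_pM ?mulr_ge0 ?normc_ge0//.
  by rewrite ler_pM ?normc_ge0 ?disc_norm// ptrans_lip.
by rewrite ler_pM ?normc_ge0 ?normc_V1ptrans.
Qed.

End small.

End Transforms.

(** * Rooted trees and tame vertex functions *)

(* [Graft a b] makes the root of [b] a child of the root of [a]; every finite
   rooted tree arises in this way, but only the converse is needed. *)
Inductive gtree := Leaf | Graft of gtree & gtree.

Fixpoint vertices (t : gtree) : finType :=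
  if t is Graft a b then (vertices a + vertices b)%type : finType
  else unit : finType.

Fixpoint groot (t : gtree) : vertices t :=
  match t with Leaf => tt | Graft a b => inl (groot a) end.

Fixpoint gedge (t : gtree) : rel (vertices t) :=
  match t with
  | Leaf => fun _ _ => false
  | Graft a b => fun x y =>
      match x, y with
      | inl x', inl y' => gedge x' y'
      | inr x', inr y' => gedge x' y'
      | inl x', inr y' => (x' == groot a) && (y' == groot b)
      | inr _, inl _ => false
      end
  end.

Section GraftPaths.
Variables a b : gtree.
Let e : rel (vertices (Graft a b)) := @gedge (Graft a b).
Implicit Types (p : seq (vertices a + vertices b)).

Lemma path_graft_inr (x : vertices b) p :
  path e (inr x) p -> exists2 q, p = map inr q & path (@gedge b) x q.
Proof.
elim: p x => [|[y|y] p IH] x /=; [by exists [::]|by []|].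
by case/andP=> xy /IH[q -> pq]; exists (y :: q) => //=; apply/andP; split.
Qed.

(** The only edge between the two parts goes from the root of [a] to the root of [b], and none leads
    back, so a path crosses at most once. *)
Lemma path_graft_inl (x : vertices a) p : path e (inl x) p ->
  (exists2 q, p = map inl q & path (@gedge a) x q) \/
  (exists q q', [/\ p = map inl q ++ inr (groot b) :: map inr q',
     path (@gedge a) x q, last x q = groot a & path (@gedge b) (groot b) q']).
Proof.
elim: p x => [|[y|y] p IH] x; first by left; exists [::].
- case/andP=> xy /IH[[q -> pq]|[q [q' [-> pq lq pq']]]].
    by left; exists (y :: q) => //=; rewrite pq andbT; exact: xy.
  right; exists (y :: q), q'; split=> //=; rewrite pq andbT; exact: xy.
- case/andP=> /andP[/eqP -> /eqP ->] /path_graft_inr[q' -> pq'].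
  by right; exists [::], q'.
Qed.

Lemma path_map_inl (x : vertices a) q :
  path e (inl x) (map inl q) = path (@gedge a) x q.
Proof. by elim: q x => //= y q IH x; rewrite -IH. Qed.

Lemma path_map_inr (x : vertices b) q :
  path e (inr x) (map inr q) = path (@gedge b) x q.
Proof. by elim: q x => //= y q IH x; rewrite -IH. Qed.

End GraftPaths.

Lemma rooted_tree_gtree t : rooted_tree (@gedge t) (groot t).
Proof.
elim: t => [|a [da ua] b [db ub]].
  split=> // -[]; exists [::]; split=> // p [].
  by case: p.
split; first by case=> v; [exact: da|exact: db].
(* A path into [b] first runs inside [a] and ends at the root of [a]; this part has to be empty. *)
have ra q : path (@gedge a) (groot a) q -> last (groot a) q = groot a -> q = [::].
  move=> pq lq; have [p [_ up]] := ua (groot a).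
  by rewrite -(up q)// -(up [::]).
case=> w.
  have [p [[pp lp] up]] := ua w.
  exists (map inl p); split.
    by split; [rewrite path_map_inl|rewrite last_map lp].
  move=> q [/path_graft_inl[[q1 -> pq1]|[q1 [q2 [-> _ _ _]]]]].
    by rewrite last_map => -[] lq1; rewrite (up q1).
  by rewrite last_cat /= last_map.
have [p [[pp lp] up]] := ub w.
exists (inr (groot b) :: map inr p); split.
  split; last by rewrite /= last_map lp.
  by rewrite /= !eqxx (path_map_inr a).
move=> q [/path_graft_inl[[q1 -> pq1]|[q1 [q2 [-> pq1 lq1 pq2]]]]].
  by rewrite last_map.
rewrite last_cat /= last_map => -[] lq2.
by rewrite (ra q1)//= (up q2).
Qed.

Section RootedCount.
Variables (V : finType) (E : rel V).

Definition homs_at t v := #|finset (fun f => (f \in homs (@gedge t) E) && (f (groot t) == v))|.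

Lemma homsP t (f : {ffun vertices t -> V}) :
  reflect (forall x y, gedge x y -> E (f x) (f y)) (f \in homs (@gedge t) E).
Proof.
rewrite inE; apply: (iffP forallP) => [h x y xy|h x].
  by have /forallP/(_ y)/implyP := h x; apply.
by apply/forallP => y; apply/implyP; exact: h.
Qed.

Lemma homs_at_leaf v : homs_at Leaf v = 1%N.
Proof.
pose f0 : {ffun vertices Leaf -> V} := [ffun=> v].
rewrite /homs_at -(cards1 f0); apply: eq_card => f.
rewrite finset.in_set finset.in_set1; apply/andP/eqP.
  by move=> [_ /eqP fv]; apply/ffunP => -[]; rewrite ffunE.
by move=> ->; split; [apply/homsP|rewrite ffunE].
Qed.

Definition join_ffun (S T : finType) (fg : {ffun S -> V} * {ffun T -> V}) :
    {ffun S + T -> V} :=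
  [ffun x => match x with inl s => fg.1 s | inr t => fg.2 t end].

Lemma join_ffun_inj S T : injective (@join_ffun S T).
Proof.
move=> [f g] [f' g'] /ffunP h; congr pair; apply/ffunP => x.
  by have := h (inl x); rewrite !ffunE.
by have := h (inr x); rewrite !ffunE.
Qed.

(** The two halves of a homomorphism are constrained jointly only by the bridging edge, hence by
    [E v w] with w the image of the root of [b]; so the count factors. *)
Lemma homs_at_graft a b v :
  homs_at (Graft a b) v = (homs_at a v * \sum_(w | E v w) homs_at b w)%N.
Proof.
pose B := finset (fun g => (g \in homs (@gedge b) E) && E v (g (groot b))).
have -> : (\sum_(w | E v w) homs_at b w)%N = #|B|.
  rewrite -sum1_card (partition_big (fun g : {ffun vertices b -> V} => g (groot b))
    (fun w => E v w)) /=; last by move=> g; rewrite inE => /andP[].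
  apply: eq_bigr => w vw; rewrite sum1_card /homs_at; apply: eq_card => g.
  rewrite finset.in_set; apply/andP/andP => [[gh /eqP gw]|[]].
    by rewrite /B gw eqxx; split=> //; apply: (introT setIdP); rewrite gw.
  by move=> /setIdP[].
rewrite -cardsX -(card_imset _ (@join_ffun_inj (vertices a) (vertices b))).
apply: eq_card => f; rewrite finset.in_set; apply/andP/imsetP.
  move=> [/homsP fh /eqP /= fv].
  exists ([ffun x => f (inl x)], [ffun x => f (inr x)]); last first.
    by apply/ffunP => -[x|x]; rewrite !ffunE /= ?ffunE.
  rewrite finset.in_setX; apply/andP; split; apply/setIdP; rewrite !ffunE /= ?fv; split=> //.
  - by apply/homsP => x y xy; rewrite !ffunE; exact: fh.
  - by apply/homsP => x y xy; rewrite !ffunE; exact: fh.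
  - by rewrite -fv; apply: fh; rewrite /= !eqxx.
move=> [[g h]]; rewrite finset.in_setX /= => /andP[/setIdP[gh /eqP gv] /setIdP[hh vh]] ->.
split; last by rewrite ffunE gv.
have {}gh := elimT (@homsP a g) gh; have {}hh := elimT (@homsP b h) hh.
apply: (introT (@homsP (Graft a b) _)) => -[x|x] [y|y] /=; rewrite !ffunE /=; [exact: gh| |by []|exact: hh].
by move=> /andP[/eqP -> /eqP ->]; rewrite gv.
Qed.

Lemma homs_at_sum t : (\sum_v homs_at t v)%N = #|homs (@gedge t) E|.
Proof.
rewrite -sum1_card (partition_big (fun f : {ffun vertices t -> V} => f (groot t))
  xpredT)//=.
apply: eq_bigr => v _; rewrite sum1_card /homs_at; apply: eq_card => f.
by rewrite finset.in_set.
Qed.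

End RootedCount.

Section TreeFunctionals.
Variables (R : realType) (V : finType) (E : rel V).
Local Notation toC := (complex.real_complex R).
Implicit Types (x : V -> C R).

Definition outavg x (v : V) : C R := (\sum_(w | E v w) x w) / #|V|%:R.

Definition avg x : C R := (\sum_v x v) / #|V|%:R.

Lemma normc_outavg_avg x v : normc (outavg x v) <= (\sum_w normc (x w)) / #|V|%:R.
Proof.
rewrite /outavg normcM normcV normc_nat ler_wpM2r ?invr_ge0//.
apply: le_trans (le_normc_sum _ _ _) _.
by rewrite big_mkcond /=; apply: ler_sum => w _; case: ifP => // _; exact: normc_ge0.
Qed.

Lemma avg_le_const (f : V -> R) B : 0 <= B -> (forall w, f w <= B) ->
  (\sum_w f w) / #|V|%:R <= B.
Proof.
(* For empty [V] the quotient is 0, the inverse of 0 being 0, and [B0] concludes. *)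
move=> B0 fB; have [V0|V0] := posnP #|V|.
  by rewrite V0 invr0 mulr0.
rewrite ler_pdivrMr ?ltr0n//.
apply: (@le_trans _ _ (\sum_(w : V) B)); first by apply: ler_sum => w _; exact: fB.
by rewrite sumr_const mulr_natr; exact: lexx.
Qed.

Lemma normc_outavg x B v : (forall w, normc (x w) <= B) -> normc (outavg x v) <= B.
Proof.
move=> xB; apply: le_trans (normc_outavg_avg _ _) _.
apply: (avg_le_const (f := fun w => normc (x w))) => //.
exact: le_trans (normc_ge0 _) (xB v).
Qed.

Lemma normc_avg x B : 0 <= B -> (forall w, normc (x w) <= B) -> normc (avg x) <= B.
Proof.
move=> B0 xB; rewrite /avg normcM normcV normc_nat.
apply: le_trans (avg_le_const (f := fun w => normc (x w)) B0 xB).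
by rewrite ler_wpM2r ?invr_ge0// le_normc_sum.
Qed.

Lemma outavgB x x' v : outavg x v - outavg x' v = outavg (fun w => x w - x' w) v.
Proof. by rewrite /outavg -mulrBl sumrB. Qed.

Lemma avgB x x' : avg x - avg x' = avg (fun w => x w - x' w).
Proof. by rewrite /avg -mulrBl sumrB. Qed.

Fixpoint phi (t : gtree) : V -> C R :=
  if t is Graft a b then fun v => phi a v * outavg (phi b) v else fun=> 1.

(** Both sides carry an extra factor |V|, which avoids the exponent |T| - 1. *)
Lemma homs_at_phi t v :
  (homs_at E t v)%:R * #|V|%:R = phi t v * #|V|%:R ^+ #|vertices t| :> C R.
Proof.
have N0 : (#|V|%:R : C R) != 0.
  by rewrite pnatr_eq0 -lt0n; apply/card_gt0P; exists v.
elim: t v => [|a IHa b IHb] v /=.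
  by rewrite homs_at_leaf !mul1r card_unit expr1.
rewrite homs_at_graft card_sum exprD natrM natr_sum; apply: (mulIf N0).
transitivity (phi a v * #|V|%:R ^+ #|vertices a| *
              \sum_(w | E v w) ((homs_at E b w)%:R * #|V|%:R)).
  by rewrite -IHa -mulr_suml; ring.
under eq_bigr do rewrite IHb.
by rewrite -mulr_suml /outavg; field.
Qed.

Lemma avg_phi t : (0 < #|V|)%N -> avg (phi t) = toC (hom_density R (@gedge t) E).
Proof.
move=> V0; have N0 : (#|V|%:R : C R) != 0 by rewrite pnatr_eq0 -lt0n.
rewrite /hom_density fmorph_div rmorphXn !rmorph_nat -homs_at_sum natr_sum.
apply/eqP; rewrite /avg eq_sym.
rewrite eqr_div ?expf_neq0// !mulr_suml; apply/eqP/eq_bigr => v _.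
by rewrite homs_at_phi.
Qed.

Lemma normc_phi t v : normc (phi t v) <= 1.
Proof.
elim: t v => [|a IHa b IHb] v; first by rewrite [phi _]/= normc1.
rewrite [phi _]/= normcM -[leRHS]mulr1 ler_pM ?normc_ge0//.
exact: normc_outavg.
Qed.

(** Gluing of two trees at their roots: the constraints below a common root are independent, so
    [phi] becomes multiplicative and tree combinations form an algebra. *)
Fixpoint gmul (s t : gtree) : gtree :=
  if t is Graft a b then Graft (gmul s a) b else s.

Lemma phi_gmul s t v : phi (gmul s t) v = phi s v * phi t v.
Proof. by elim: t => [|a IHa b _] /=; rewrite ?mulr1// IHa mulrA. Qed.

Definition treecomb (T : seq (C R * gtree)) v := \sum_(p <- T) p.1 * phi p.2 v.

Lemma treecomb_cat S T v : treecomb (S ++ T) v = treecomb S v + treecomb T v.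
Proof. by rewrite /treecomb big_cat. Qed.

Lemma treecombM S T v :
  treecomb [seq (p.1 * q.1, gmul p.2 q.2) | p <- S, q <- T] v =
  treecomb S v * treecomb T v.
Proof.
rewrite /treecomb big_allpairs_dep /= mulr_suml; apply: eq_bigr => p _.
by rewrite mulr_sumr; apply: eq_bigr => q _; rewrite phi_gmul; ring.
Qed.

(** Grafting onto a single vertex puts a new root above the old one, and a sum over its image's
    out-neighbours appears. *)
Lemma treecomb_outavg T v :
  treecomb [seq (p.1, Graft Leaf p.2) | p <- T] v = outavg (treecomb T) v.
Proof.
rewrite /treecomb big_map /= /outavg exchange_big /= mulr_suml.
by apply: eq_bigr => p _; rewrite mul1r -mulr_sumr mulrA.
Qed.

Lemma avg_treecomb T : avg (treecomb T) = \sum_(p <- T) p.1 * avg (phi p.2).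
Proof.
rewrite /treecomb /avg exchange_big /= mulr_suml.
by apply: eq_bigr => p _; rewrite -mulr_sumr mulrA.
Qed.

Lemma normc_treecomb T v : normc (treecomb T v) <= \sum_(p <- T) normc p.1.
Proof.
apply: le_trans (le_normc_sum _ _ _) _; apply: ler_sum => p _.
by rewrite normcM ler_piMr ?normc_ge0// normc_phi.
Qed.

End TreeFunctionals.

(** * Convergence of complex sequences *)

Section ComplexSequences.
Variable R : realType.
Implicit Types (u : nat -> C R) (l : C R).

Definition ccvg u l :=
  forall e : R, 0 < e -> \forall n \near \oo, normc (u n - l) <= e.

(** The number [l] may depend on [e]: by the Cauchy criterion approximate limits suffice. This
    carries convergence across uniform approximations whose own limits are unrelated. *)
Lemma real_cvg_approx (u : nat -> R) :
  (forall e : R, 0 < e -> exists l : R, \forall n \near \oo, `|u n - l| <= e) ->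
  cvgn u.
Proof.
move=> h; apply: cauchy_cvg; apply: cauchy_exP => e e0.
have e20 : 0 < e / 2 by rewrite divr_gt0.
have [l hl] := h _ e20.
exists l; move: hl; apply: filterS => n; rewrite /ball /= distrC => /le_lt_trans.
by apply; lra.
Qed.

Lemma ccvg_approx u :
  (forall e : R, 0 < e -> exists l, \forall n \near \oo, normc (u n - l) <= e) ->
  exists l, ccvg u l.
Proof.
move=> h.
have /cvg_ex[lr Hr] : cvgn (fun n => Re (u n)).
  apply: real_cvg_approx => e /h[l hl]; exists (Re l); move: hl; apply: filterS => n.
  by apply: le_trans; rewrite (_ : Re (u n) - _ = Re (u n - l)) ?le_normc_Re//;
    case: (u n); case: l.
have /cvg_ex[li Hi] : cvgn (fun n => Im (u n)).
  apply: real_cvg_approx => e /h[l hl]; exists (Im l); move: hl; apply: filterS => n.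
  by apply: le_trans; rewrite (_ : Im (u n) - _ = Im (u n - l)) ?le_normc_Im//;
    case: (u n); case: l.
exists (complex.Complex lr li) => e e0; have e20 : 0 < e / 2 by rewrite divr_gt0.
move/cvgrPdist_le: Hr => /(_ _ e20) Hr; move/cvgrPdist_le: Hi => /(_ _ e20) Hi.
move: Hr Hi; apply: filterS2 => n; case: (u n) => a b h1 h2.
apply: le_trans (normc_le_ReIm _) _; move: h1 h2 => /= h1 h2.
by rewrite (distrC a) (distrC b); lra.
Qed.

Lemma ccvg_ReIm u (a b : R) : (fun n => Re (u n)) @ \oo --> a ->
  (fun n => Im (u n)) @ \oo --> b -> ccvg u (complex.Complex a b).
Proof.
move=> Hr Hi e e0; have e20 : 0 < e / 2 by rewrite divr_gt0.
move/cvgrPdist_le: Hr => /(_ _ e20) Hr; move/cvgrPdist_le: Hi => /(_ _ e20) Hi.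
move: Hr Hi; apply: filterS2 => n; case: (u n) => c d h1 h2.
apply: le_trans (normc_le_ReIm _) _; move: h1 h2 => /= h1 h2.
by rewrite (distrC c) (distrC d); lra.
Qed.

Lemma ccvgD u u' l l' : ccvg u l -> ccvg u' l' -> ccvg (fun n => u n + u' n) (l + l').
Proof.
move=> h h' e e0; have e20 : 0 < e / 2 by rewrite divr_gt0.
move: (h _ e20) (h' _ e20); apply: filterS2 => n h1 h2.
rewrite opprD addrACA (le_trans (complex.le_normcD _ _))//; lra.
Qed.

Lemma ccvg_cst l : ccvg (fun=> l) l.
Proof. by move=> e e0; apply: nearW => n; rewrite subrr normc0 ltW. Qed.

Lemma ccvgZ c u l : ccvg u l -> ccvg (fun n => c * u n) (c * l).
Proof.
move=> h e e0; have c0 : 0 < normc c + 1 by have := normc_ge0 c; lra.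
move: (h _ (divr_gt0 e0 c0)); apply: filterS => n hn.
rewrite -mulrBr normcM; move: hn; rewrite ler_pdivlMr// mulrC; apply: le_trans.
by rewrite ler_wpM2r ?normc_ge0// lerDl.
Qed.

End ComplexSequences.

Section TameFamilies.
Variables (R : realType) (V : nat -> finType) (E : forall n, rel (V n)).
Hypothesis V_gt0 : \forall n \near \oo, (0 < #|V n|)%N.
Hypothesis densities : forall t, exists l : R,
  (fun n => hom_density R (@gedge t) (@E n)) @ \oo --> l.
Implicit Types (x y : forall n, V n -> C R).

(* One combination [T] serves all large [n]: this is what lets the limits of
   the densities determine the limit of [avg x]. *)
Definition tame x := forall d : R, 0 < d -> exists T,
  \forall n \near \oo, forall v, normc (x n v - treecomb (@E n) T v) <= d.

Lemma tame_bounded x : tame x ->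
  exists2 B, 0 < B & \forall n \near \oo, forall v, normc (x n v) <= B.
Proof.
move=> /(_ 1 ltr01)[T HT].
have S0 : 0 <= \sum_(p <- T) normc p.1 by rewrite sumr_ge0// => p _; exact: normc_ge0.
exists (1 + \sum_(p <- T) normc p.1); first by lra.
move: HT; apply: filterS => n h v.
rewrite -(subrK (treecomb (@E n) T v) (x n v)).
by rewrite (le_trans (complex.le_normcD _ _))// lerD// normc_treecomb.
Qed.

Lemma tame_lim x :
  (forall d : R, 0 < d -> exists2 y, tame y &
     \forall n \near \oo, forall v, normc (x n v - y n v) <= d) -> tame x.
Proof.
move=> h d d0; have d20 : 0 < d / 2 by rewrite divr_gt0.
have [y ty xy] := h _ d20; have [T HT] := ty _ d20; exists T.
move: xy HT; apply: filterS2 => n h1 h2 v.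
by apply: le_trans (le_normc_distD _ (y n v) _) _; have := h1 v; have := h2 v; lra.
Qed.

Lemma tame_ext x y : tame x -> (forall n v, x n v = y n v) -> tame y.
Proof.
move=> tx xy d /tx[T HT]; exists T; move: HT; apply: filterS => n h v.
by rewrite -xy.
Qed.

Lemma tame_cst (c : nat -> C R) l : ccvg c l -> tame (fun n _ => c n).
Proof.
move=> cl d d0; exists [:: (l, Leaf)]; move: (cl d d0); apply: filterS => n h v.
by rewrite /treecomb big_seq1 /= mulr1.
Qed.

Lemma tameD x y : tame x -> tame y -> tame (fun n v => x n v + y n v).
Proof.
move=> tx ty d d0; have d20 : 0 < d / 2 by rewrite divr_gt0.
have [S HS] := tx _ d20; have [T HT] := ty _ d20; exists (S ++ T).
move: HS HT; apply: filterS2 => n h1 h2 v; rewrite treecomb_cat.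
rewrite opprD addrACA (le_trans (complex.le_normcD _ _))//.
by have := h1 v; have := h2 v; lra.
Qed.

Lemma tameM x y : tame x -> tame y -> tame (fun n v => x n v * y n v).
Proof.
move=> tx ty d d0; have [B B0 HB] := tame_bounded ty.
have dB0 : 0 < d / (2 * B) by rewrite divr_gt0// mulr_gt0.
have [S HS] := tx _ dB0.
(* The precision required of [T] depends on the size of [S], so [S] is fixed first; its precision in
   turn uses the bound [B] of [y]. *)
pose A := 1 + \sum_(p <- S) normc p.1.
have A0 : 0 < A.
  have : 0 <= \sum_(p <- S) normc p.1.
    by rewrite sumr_ge0// => p _; exact: normc_ge0.
  by rewrite /A; lra.
have dA0 : 0 < d / (2 * A) by rewrite divr_gt0// mulr_gt0.
have [T HT] := ty _ dA0.
exists [seq (p.1 * q.1, gmul p.2 q.2) | p <- S, q <- T].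
move: HB HS HT; apply: filterS3 => n hB hS hT v; rewrite treecombM.
have -> : x n v * y n v - treecomb (@E n) S v * treecomb (@E n) T v =
  (x n v - treecomb (@E n) S v) * y n v +
  treecomb (@E n) S v * (y n v - treecomb (@E n) T v) by ring.
apply: le_trans (complex.le_normcD _ _) _; rewrite !normcM.
have -> : d = d / (2 * B) * B + A * (d / (2 * A)).
  by field; rewrite !gt_eqF.
rewrite lerD// ler_pM ?normc_ge0//.
by apply: le_trans (normc_treecomb _ _ _) _; rewrite /A lerDr.
Qed.

Lemma tame_outavg x : tame x -> tame (fun n v => outavg (@E n) (x n) v).
Proof.
move=> tx d d0; have [T HT] := tx d d0.
exists [seq (p.1, Graft Leaf p.2) | p <- T].
move: HT; apply: filterS => n h v; rewrite treecomb_outavg outavgB.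
exact: normc_outavg.
Qed.

Lemma tameX x k : tame x -> tame (fun n v => x n v ^+ k).
Proof.
move=> tx; elim: k => [|k IH]; first exact: tame_cst (ccvg_cst 1).
by apply: (tame_ext (tameM tx IH)) => n v; rewrite exprS.
Qed.

Lemma tame_sum k (c : nat -> forall n, V n -> C R) :
  (forall j, tame (c j)) -> tame (fun n v => \sum_(j < k) c j n v).
Proof.
move=> tc; elim: k => [|k IH].
  by apply: (tame_ext (tame_cst (ccvg_cst 0))) => n v; rewrite big_ord0.
by apply: (tame_ext (tameD IH (tc k))) => n v; rewrite big_ord_recr.
Qed.

(** This is where the densities enter: the average of [phi t] is the homomorphism density of [t]. *)
Lemma tame_avg x : tame x -> exists l, ccvg (fun n => avg (x n)) l.
Proof.
move=> tx; apply: ccvg_approx => e e0; have e20 : 0 < e / 2 by rewrite divr_gt0.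
have [T HT] := tx _ e20.
have [l Hl] : exists l, ccvg (fun n => avg (treecomb (@E n) T)) l.
  suff [l Hl] : exists l, ccvg (fun n => \sum_(p <- T) p.1 *
      complex.real_complex R (hom_density R (@gedge p.2) (@E n))) l.
    exists l => d d0; move: V_gt0 (Hl d d0); apply: filterS2 => n V0.
    rewrite avg_treecomb; under eq_bigr do rewrite -(avg_phi _ _ _ V0).
    by [].
  elim: T {HT} => [|p T [l Hl]].
    by exists 0; under eq_fun do rewrite big_nil; exact: ccvg_cst.
  have [b Hb] := densities p.2.
  exists (p.1 * complex.real_complex R b + l).
  under eq_fun do rewrite big_cons.
  apply: ccvgD Hl; apply: ccvgZ; apply: ccvg_ReIm => //.
  exact: cvg_cst.
exists l; move: HT (Hl _ e20); apply: filterS2 => n h1 h2.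
apply: le_trans (le_normc_distD _ (avg (treecomb (@E n) T)) _) _.
have : normc (avg (x n) - avg (treecomb (@E n) T)) <= e / 2.
  by rewrite avgB; apply: normc_avg => //; exact: ltW.
by lra.
Qed.

End TameFamilies.

(** * Continuity of the transforms along the imaginary axis *)

Section AxisContinuity.
Variable R : realType.
Implicit Types (rho : prob R) (z w : C R) (y t : R).
Local Notation toC := (complex.real_complex R).
Local Notation iy y := (complex.Complex 0 y : C R).

Lemma disc_center y : 0 < y -> disc y (iy y).
Proof. by move=> y0; split; rewrite // subrr normc0 divr_ge0// ltW. Qed.

Lemma iyB (y y' : R) : iy y - iy y' = complex.Complex 0 (y - y').
Proof. by rewrite -[LHS]/(complex.Complex (0 - 0) (y - y')) subr0. Qed.

Lemma normc_iyB (y y' : R) : normc (iy y - iy y') = `|y - y'|.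
Proof. by rewrite iyB /= expr0n /= add0r sqrtr_sqr. Qed.

Lemma cauchy_lip y rho z w : disc y z -> disc y w ->
  normc (cauchy rho z - cauchy rho w) <= 32 / y ^+ 2 * normc (z - w).
Proof.
move=> dz dw; have y0 := dz.1.
have z0 t := disc_neq t dz; have w0 t := disc_neq t dw.
rewrite !cauchyE -cintB; [|exact: ccont_kern|exact: cbd_kern dz|
                  exact: ccont_kern|exact: cbd_kern dw].
have -> : (fun t => kern z t - kern w t) =
          (fun t => (w - z) * (kern z t * kern w t)).
  by apply/funext => t; rewrite /kern; field; rewrite z0 w0.
have cq : ccont (fun t => kern z t * kern w t).
  by apply: ccontM; exact: ccont_kern.
have qb t : normc (kern z t * kern w t) <= 16 / y ^+ 2.
  rewrite normcM.
  have -> : 16 / y ^+ 2 = (4 / y) * (4 / y) by field; rewrite gt_eqF.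
  by rewrite ler_pM ?normc_ge0 ?normc_kern_le.
rewrite cintZ//; last by exists (16 / y ^+ 2).
rewrite normcM normc_distC mulrC ler_wpM2r ?normc_ge0//.
apply: (le_trans (normc_cint rho cq (bmf_cst _) qb)).
by rewrite int_cst mulrA -natrM.
Qed.

(** Needed for the measures [nu v], for which no smallness of [etheta] is known at the relevant [y].
    Minus the imaginary part is the integral of the positive function y/(t^2+y^2). *)
Lemma cauchy_axis_neq0 rho y : 0 < y -> cauchy rho (iy y) != 0.
Proof.
move=> y0.
have e40 : 0 < 1 / 4 :> R by rewrite divr_gt0.
have [Y Y0 /(_ _ (lexx Y)) HY] := etheta_cvg0 rho e40.
have D0 t : 0 < t ^+ 2 + y ^+ 2 by rewrite ltr_wpDl ?sqr_ge0// exprn_gt0.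
have DY0 := D0 Y.
have cf : bmf (fun t => y / (t ^+ 2 + y ^+ 2)).
  apply: (bmf_continuous (M := 1 / y)).
    move=> t; apply: cvgM; first exact: cvg_cst.
    apply: cvgV; first by rewrite gt_eqF.
    apply: cvgD; last exact: cvg_cst.
    by apply: (cvgM _ _); exact: cvg_id.
  move=> t; have Dt := D0 t.
  rewrite ger0_norm; last by rewrite divr_ge0// ltW.
  rewrite ler_pdivrMr// mulrAC mul1r ler_pdivlMr// -expr2.
  by rewrite lerDr sqr_ge0.
(* The function 1 - 2 [theta Y] replaces the indicator of [-Y, Y]: it is at most 1, at most 0 beyond
   Y where [theta] is at least 1/2, and its integral is at least 1 - 2/4. *)
have lb : (y / (Y ^+ 2 + y ^+ 2)) * (1 / 2) <=
    Rintegral rho setT (fun t => y / (t ^+ 2 + y ^+ 2)).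
  apply: (@le_trans _ _ (Rintegral rho setT
    (fun t => y / (Y ^+ 2 + y ^+ 2) * (1 - 2 * theta Y t)))).
    rewrite intZ; last by apply: bmfB; [exact: bmf_cst|apply: bmfZ; exact: bmf_theta].
    rewrite ler_wpM2l ?divr_ge0 ?(ltW y0) ?(ltW DY0)//.
    rewrite intB; [|exact: bmf_cst|apply: bmfZ; exact: bmf_theta].
    rewrite int_cst intZ; last exact: bmf_theta.
    by rewrite -/(etheta rho Y); lra.
  apply: le_int => //.
    by apply: bmfZ; apply: bmfB; [exact: bmf_cst|apply: bmfZ; exact: bmf_theta].
  move=> t; have t1 := theta_ge0 t Y0.
  have [tY|Yt] := lerP `|t| Y.
    apply: (@le_trans _ _ (y / (Y ^+ 2 + y ^+ 2))).
      by rewrite ler_piMr ?divr_ge0 ?(ltW y0) ?(ltW DY0)//; lra.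
    rewrite ler_wpM2l ?(ltW y0)// lef_pV2 ?posrE// lerD2r.
    by rewrite -[t ^+ 2]real_normK ?num_real// ler_sqr ?nnegrE// ltW.
  apply: (@le_trans _ _ 0); last by rewrite divr_ge0 ?ltW.
  rewrite mulr_ge0_le0 ?divr_ge0 ?(ltW y0) ?(ltW DY0)// subr_le0 /theta mulrA.
  by rewrite ler_pdivlMr ?theta_den// mul1r; lra.
apply/negP => /eqP /(congr1 (@complex.Im R)) /=.
under eq_Rintegral do rewrite sub0r sqrrN mulNr -mulN1r.
rewrite intZ// mulN1r => /eqP; rewrite oppr_eq0 => /eqP I0.
by move: lb; rewrite I0 leNgt mulr_gt0// divr_gt0.
Qed.

End AxisContinuity.

(** * The fixed point along the imaginary axis *)

Section KtransContinuity.
Variable R : realType.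
Implicit Types (rho : prob R) (y : R).
Local Notation iy y := (complex.Complex 0 y : C R).

Lemma continuous_cauchy_axis rho (p : C R -> R) y : 0 < y ->
  (forall z w, `|p z - p w| <= normc (z - w)) ->
  {for y, continuous (fun y => p (cauchy rho (iy y)))}.
Proof.
move=> y0 pl; apply/cvgrPdist_le => e e0.
have C0 : 0 < 32 / y ^+ 2 by rewrite divr_gt0// exprn_gt0.
have y40 : 0 < y / 4 by rewrite divr_gt0.
have := @cvg_id _ (nbhs y) => /cvgrPdist_le H.
move: (H _ (divr_gt0 e0 C0)) (H _ y40); apply: filterS2 => y' h1 h2.
apply: le_trans (pl _ _) _; apply: le_trans (cauchy_lip rho (disc_center y0) _) _.
  by split; rewrite // normc_iyB distrC.
by rewrite normc_iyB mulrC -ler_pdivlMr.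
Qed.

Lemma Re_lip (z w : C R) : `|Re z - Re w| <= normc (z - w).
Proof. by apply: le_trans (le_normc_Re _); case: z; case: w. Qed.

Lemma Im_lip (z w : C R) : `|Im z - Im w| <= normc (z - w).
Proof. by apply: le_trans (le_normc_Im _); case: z; case: w. Qed.

Lemma continuous_Ktrans_axis rho y : 0 < y ->
  {for y, continuous (fun y => normc (Ktrans rho (iy y)))}.
Proof.
move=> y0.
pose a y := Re (cauchy rho (iy y)); pose b y := Im (cauchy rho (iy y)).
have ca : {for y, continuous a} := @continuous_cauchy_axis rho _ _ y0 Re_lip.
have cb : {for y, continuous b} := @continuous_cauchy_axis rho _ _ y0 Im_lip.
have cD : {for y, continuous (fun y => (a y ^+ 2 + b y ^+ 2)^-1)}.
  apply: cvgV; first by rewrite ReIm2_eq0 cauchy_axis_neq0.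
  by apply: cvgD; apply: (cvgM _ _).
have -> : (fun y => normc (Ktrans rho (iy y))) =
    (fun y => Num.sqrt ((- (a y * (a y ^+ 2 + b y ^+ 2)^-1)) *
                        (- (a y * (a y ^+ 2 + b y ^+ 2)^-1)) +
       (y + b y * (a y ^+ 2 + b y ^+ 2)^-1) *
       (y + b y * (a y ^+ 2 + b y ^+ 2)^-1))).
  apply/funext => u; rewrite normcE /Ktrans -!expr2.
  have -> : Re (iy u - (cauchy rho (iy u))^-1) =
            - (a u * (a u ^+ 2 + b u ^+ 2)^-1).
    by rewrite /a /b; case: (cauchy rho (iy u)) => c d /=; rewrite sub0r.
  have -> : Im (iy u - (cauchy rho (iy u))^-1) =
            u + b u * (a u ^+ 2 + b u ^+ 2)^-1.
    by rewrite /a /b; case: (cauchy rho (iy u)) => c d /=; rewrite opprK.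
  by [].
apply: continuous_comp; last exact: sqrt_continuous.
have c1 : {for y, continuous (fun y => - (a y * (a y ^+ 2 + b y ^+ 2)^-1))}.
  by apply: cvgN; apply: cvgM.
have c2 : {for y, continuous (fun y => y + b y * (a y ^+ 2 + b y ^+ 2)^-1)}.
  by apply: cvgD; [exact: cvg_id|apply: cvgM].
by apply: cvgD; apply: cvgM.
Qed.

End KtransContinuity.

Section Bootstrap.
Variables (R : realType) (V : finType) (E : rel V).
Variables (m bp : prob R) (nu : V -> prob R).
Local Notation iy y := (complex.Complex 0 y : C R).
Local Notation g y v := (#|V|%:R * Ktrans (nu v) (iy y)).
Hypothesis V_gt0 : (0 < #|V|)%N.
Hypothesis bpE : is_boolean_power m #|V| bp.
Hypothesis nuE : forall v z, upper z ->
  Ktrans (nu v) z = Ktrans m (z - \sum_(w | E v w) Ktrans (nu w) z).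

Let N0 : (#|V|%:R : C R) != 0.
Proof. by rewrite pnatr_eq0 -lt0n. Qed.

Let NR0 : 0 < #|V|%:R :> R.
Proof. by rewrite ltr0n. Qed.

(** Multiplying the defining equation by |V| turns the sum of the K-transforms into [outavg] of g.
    The smallness keeps the argument in the upper half-plane, where the boolean power is
    specified. *)
Lemma fixed_point_eq (y : R) v : 0 < y ->
  normc (outavg E (fun w => g y w) v) <= y / 4 ->
  g y v = Ktrans bp (iy y - outavg E (fun w => g y w) v).
Proof.
move=> y0 small.
have d : disc y (iy y - outavg E (fun w => g y w) v).
  by split=> //; rewrite addrAC subrr sub0r complex.normcN.
rewrite bpE; last exact: disc_upper d.
rewrite nuE//; congr (_ * Ktrans _ (_ - _)).
by rewrite /outavg -mulr_sumr mulrAC divff ?mul1r.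
Qed.

(** The self-improving step. The mean over all vertices is assumed small rather than the maximum: it
    bounds every [outavg], and as a finite sum it is continuous in [y]. *)
Lemma fixed_point_gap (y eps : R) v : 0 < y -> eps <= 1 / 16 ->
  etheta bp y <= eps -> (\sum_w normc (g y w)) / #|V|%:R <= y / 4 ->
  normc (g y v) <= 32 * y * eps.
Proof.
move=> y0 eps1 ebp small.
have small' := le_trans (normc_outavg_avg E (fun w => g y w) v) small.
rewrite fixed_point_eq//; apply: (@le_trans _ _ (32 * y * etheta bp y)).
  apply: normc_Ktrans; first exact: le_trans ebp eps1.
  by split=> //; rewrite addrAC subrr sub0r complex.normcN.
by rewrite ler_wpM2l// mulr_ge0// ltW.
Qed.

Let Psi (y : R) := (\sum_w normc (g y w)) / #|V|%:R / y.

Let Psi_continuous (y : R) : 0 < y -> {for y, continuous Psi}.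
Proof.
move=> y0; apply: cvgM; last by apply: cvgV; [rewrite gt_eqF|exact: cvg_id].
apply: cvgM; last exact: cvg_cst.
apply: cvg_big => [|w _]; first exact: add_continuous.
have -> : (fun y => normc (g y w)) = (fun y => #|V|%:R * normc (Ktrans (nu w) (iy y))).
  by apply/funext => u; rewrite normcM normc_nat.
by rewrite normcM normc_nat; apply: cvgM; [exact: cvg_cst|exact: continuous_Ktrans_axis].
Qed.

(** For one fixed graph the finitely many [nu w] are jointly tight. The bound [Y] depends on them,
    which is harmless for a mere starting point. *)
Let Psi_cvg0 (y : R) : exists2 Y, y <= Y & Psi Y <= 1 / 4.
Proof.
(* Chosen so that |V| * 32 * Y * e = Y/4. *)
pose e : R := 1 / (128 * #|V|%:R).
have e0 : 0 < e by rewrite divr_gt0// mulr_gt0.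
have e1 : e <= 1 / 16.
  rewrite /e ler_pdivrMr ?mulr_gt0//.
  have : 1 <= #|V|%:R :> R by rewrite ler1n.
  by lra.
have bound w : exists M, forall y, M <= y -> etheta (nu w) y <= e.
  by have [M _ HM] := etheta_cvg0 (nu w) e0; exists M.
have /choice[Mw HMw] := bound.
pose Y := `|y| + 1 + \sum_w `|Mw w|.
have S0 : 0 <= \sum_w `|Mw w| by exact: sumr_ge0.
have Y0 : 0 < Y by rewrite /Y; have := normr_ge0 y; lra.
exists Y; first by rewrite /Y; have := ler_norm y; lra.
rewrite /Psi ler_pdivrMr//; apply: avg_le_const => [|w].
  by rewrite mulr_ge0// ltW.
rewrite normcM normc_nat.
have eY : etheta (nu w) Y <= e.
  apply: HMw; apply: le_trans (ler_norm _) _.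
  rewrite /Y (bigD1 w)//= in S0 *.
  have : 0 <= \sum_(i | i != w) `|Mw i| by exact: sumr_ge0.
  by have := normr_ge0 y; lra.
apply: (@le_trans _ _ (#|V|%:R * (32 * Y * e))).
  rewrite ler_wpM2l//.
  apply: le_trans (normc_Ktrans (le_trans eY e1) (disc_center Y0)) _.
  by rewrite ler_wpM2l// mulr_ge0// ltW.
by rewrite le_eqVlt; apply/orP; left; apply/eqP; rewrite /e; field; rewrite gt_eqF.
Qed.

(* The averaged size Psi of the fixed point never lies in (1/10, 1/4], is
   continuous along the imaginary axis and vanishes at infinity. *)
Lemma fixed_point_small (M eps : R) : 0 < M -> eps <= 1 / 1000 -> etheta bp M <= eps ->
  forall (y : R) v, M <= y -> normc (g y v) <= 32 * y * eps.
Proof.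
move=> M0 eps1 ebp.
have eps2 : eps <= 1 / 16 by lra.
have eb y : M <= y -> etheta bp y <= eps.
  by move=> My; apply: le_trans (etheta_nincr bp M0 My) ebp.
(* [fixed_point_gap] gives 32 * y * eps, and 32/1000 is below 1/10. *)
have gap y : M <= y -> Psi y <= 1 / 4 -> Psi y <= 1 / 10.
  move=> My; have y0 := lt_le_trans M0 My.
  rewrite /Psi => Py; rewrite ler_pdivrMr// in Py.
  rewrite ler_pdivrMr//; apply: avg_le_const => [|w].
    by rewrite mulr_ge0// ltW.
  have Py' : (\sum_w normc (g y w)) / #|V|%:R <= y / 4 by lra.
  apply: le_trans (fixed_point_gap w y0 eps2 (eb y My) Py') _.
  have : y * eps <= y * (1 / 1000) by rewrite ler_wpM2l// ltW.
  by lra.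
move=> y v My; have y0 := lt_le_trans M0 My.
apply: fixed_point_gap => //; first exact: eb.
suff : Psi y <= 1 / 4 by rewrite /Psi ler_pdivrMr//; lra.
rewrite leNgt; apply/negP => Py.
have [Y yY PY] := Psi_cvg0 y.
have PY' := gap _ (le_trans My yY) PY.
have cP : {within `[y, Y], continuous Psi}.
  apply: continuous_in_subspaceT => u; rewrite inE /= in_itv /= => /andP[yu _].
  exact: Psi_continuous (lt_le_trans y0 yu).
(* The value 1/5 lies in the forbidden gap, between [Psi Y], at most 1/10, and [Psi y], above
   1/4. *)
have [] := @IVT R Psi y Y (1 / 5) yY cP.
  by rewrite ge_min le_max; apply/andP; split; apply/orP; [right|left]; lra.
move=> c; rewrite in_itv /= => /andP[yc _] Pc.
have := gap c (le_trans My yc); rewrite Pc; lra.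
Qed.

End Bootstrap.

(** * Expansion of the transforms *)

Section EventualSmallness.
Variable R : realType.
Variables (bp : nat -> prob R) (mu : prob R).
Hypothesis bp_cvg : weak_cvg bp mu.

(** Weak convergence is tested on the single function [theta M]; [etheta_nincr] then covers all y
    above [M] for the same n. *)
Lemma etheta_near (eps : R) : 0 < eps ->
  exists2 M, 0 < M & \forall n \near \oo, etheta (bp n) M <= eps.
Proof.
move=> eps0; have e20 : 0 < eps / 2 by rewrite divr_gt0.
have [M M0 /(_ _ (lexx M)) HM] := etheta_cvg0 mu e20.
exists M => //.
have : (fun n => etheta (bp n) M) @ \oo --> etheta mu M.
  apply: bp_cvg; first exact: continuous_theta.
  by exists 1 => t; exact: norm_theta_le1.
move=> /cvgrPdist_le /(_ _ e20); apply: filterS => n.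
by rewrite ler_norml => /andP[h _]; lra.
Qed.

Lemma ccvg_cint (q : R -> C R) : ccont q -> cbd q ->
  ccvg (fun n => cint (bp n) q) (cint mu q).
Proof.
move=> cq [M qM]; apply: ccvg_ReIm; apply: bp_cvg.
- by case: cq.
- by exists M => t; exact: le_trans (le_normc_Re _) _.
- by case: cq.
- by exists M => t; exact: le_trans (le_normc_Im _) _.
Qed.

End EventualSmallness.

Section KernelExpansion.
Variable R : realType.
Implicit Types (z w s : C R) (y t : R).
Local Notation toC := (complex.real_complex R).
Local Notation iy y := (complex.Complex 0 y : C R).

Lemma geo_expansion (q : C R) J : 1 - q != 0 ->
  (1 - q)^-1 - \sum_(j < J) q ^+ j = q ^+ J / (1 - q).
Proof.
move=> q0; have := subrX1 q J; set S := \sum_(j < J) q ^+ j => h.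
have -> : q ^+ J = 1 + (q - 1) * S by rewrite -h; ring.
by field.
Qed.

Lemma ccont_sum J (q : nat -> R -> C R) : (forall j, ccont (q j)) ->
  ccont (fun t => \sum_(j < J) q j t).
Proof.
move=> cq; elim: J => [|J IH].
  under eq_fun do rewrite big_ord0; exact: ccont_cst.
by under eq_fun do rewrite big_ord_recr /=; exact: ccontD.
Qed.

Lemma cbd_sum J (q : nat -> R -> C R) : (forall j, cbd (q j)) ->
  cbd (fun t => \sum_(j < J) q j t).
Proof.
move=> cq; elim: J => [|J IH].
  under eq_fun do rewrite big_ord0; exact: cbd_cst.
by under eq_fun do rewrite big_ord_recr /=; exact: cbdD.
Qed.

Lemma cint_sum (rho : prob R) J (q : nat -> R -> C R) :
  (forall j, ccont (q j)) -> (forall j, cbd (q j)) ->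
  cint rho (fun t => \sum_(j < J) q j t) = \sum_(j < J) cint rho (q j).
Proof.
move=> cq bq; elim: J => [|J IH].
  by rewrite big_ord0; under [X in cint _ X]eq_fun do rewrite big_ord0; rewrite cint_cst.
under [X in cint _ X]eq_fun do rewrite big_ord_recr /=.
by rewrite cintD ?IH ?big_ord_recr//; [exact: ccont_sum|exact: cbd_sum].
Qed.

(** This is t/(iy - t)^(j+1), the coefficient of x^j in t/(iy - x - t). It is bounded and continuous
    in t, so weak convergence applies to its integral. *)
Definition axis_moment y j t : C R := pker (iy y) t * kern (iy y) t ^+ j.

Lemma ccont_axis_moment y j : 0 < y -> ccont (axis_moment y j).
Proof.
move=> y0; have d t := disc_neq t (disc_center y0).
apply: ccontM; first exact: ccont_pker.
elim: j => [|j IH]; first by under eq_fun do rewrite expr0; exact: ccont_cst.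
by under eq_fun do rewrite exprS; apply: ccontM => //; exact: ccont_kern.
Qed.

Lemma cbd_axis_moment y j : 0 < y -> cbd (axis_moment y j).
Proof.
move=> y0; have d := disc_center y0.
apply: cbdM; first exact: cbd_pker d.
elim: j => [|j IH]; first by under eq_fun do rewrite expr0; exact: cbd_cst.
by under eq_fun do rewrite exprS; apply: cbdM => //; exact: cbd_kern d.
Qed.

Lemma disc_shift y x : 0 < y -> normc x <= y / 8 -> disc y (iy y - x).
Proof.
move=> y0 xy; split=> //; rewrite addrAC subrr sub0r complex.normcN; lra.
Qed.

(** A geometric series of ratio x/(iy - t), at most (y/8)(4/y) = 1/2 in modulus. The remainder is
    [pker (iy - x) t] times the J-th power of the ratio, so the bound is uniform in t and hence in
    the measure. *)
Lemma pker_expansion y x J t : 0 < y -> normc x <= y / 8 ->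
  normc (pker (iy y - x) t - \sum_(j < J) x ^+ j * axis_moment y j t) <=
  4 * (1 / 2) ^+ J.
Proof.
move=> y0 xy; have d := disc_center y0; have dx := disc_shift y0 xy.
have k0 : iy y - toC t != 0 := disc_neq t d.
have kx0 : iy y - x - toC t != 0 := disc_neq t dx.
pose q := x * kern (iy y) t.
have q0 : 1 - q != 0.
  rewrite /q /kern; have -> : 1 - x / (iy y - toC t) = (iy y - x - toC t) / (iy y - toC t).
    by field.
  by rewrite mulf_neq0 ?invr_eq0.
have pE : pker (iy y - x) t = pker (iy y) t * (1 - q)^-1.
  rewrite /pker /kern /q /kern; field; apply/andP; split=> //; rewrite addrAC; exact: kx0.
have -> : \sum_(j < J) x ^+ j * axis_moment y j t =
          pker (iy y) t * \sum_(j < J) q ^+ j.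
  by rewrite mulr_sumr; apply: eq_bigr => j _; rewrite /axis_moment /q exprMn; ring.
rewrite {1}pE -mulrBr geo_expansion// mulrCA -pE mulrC normcM normcX.
rewrite ler_pM ?exprn_ge0 ?normc_ge0//.
  by apply: le_trans (normc_pker t dx) _; have := theta_le1 t y0; lra.
rewrite lerXn2r ?nnegrE ?normc_ge0//.
rewrite /q normcM; apply: (@le_trans _ _ ((y / 8) * (4 / y))).
  by rewrite ler_pM ?normc_ge0 ?(normc_kern_le _ d).
by rewrite le_eqVlt; apply/orP; left; apply/eqP; field; rewrite gt_eqF.
Qed.

Lemma ptrans_expansion (rho : prob R) y x J : 0 < y -> normc x <= y / 8 ->
  normc (ptrans rho (iy y - x) -
         \sum_(j < J) x ^+ j * cint rho (axis_moment y j)) <= 8 * (1 / 2) ^+ J.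
Proof.
move=> y0 xy; have dx := disc_shift y0 xy.
have d0 t := disc_neq t dx.
have cm j := ccont_axis_moment j y0; have bm j := cbd_axis_moment j y0.
have cxm j : ccont (fun t => x ^+ j * axis_moment y j t).
  by apply: ccontM => //; exact: ccont_cst.
have bxm j : cbd (fun t => x ^+ j * axis_moment y j t).
  by apply: cbdM => //; exact: cbd_cst.
have -> : \sum_(j < J) x ^+ j * cint rho (axis_moment y j) =
          cint rho (fun t => \sum_(j < J) x ^+ j * axis_moment y j t).
  by rewrite (cint_sum _ _ cxm bxm); apply: eq_bigr => j _; rewrite cintZ.
rewrite -cintB; [|exact: ccont_pker|exact: cbd_pker dx|exact: (ccont_sum _ cxm)|
  exact: (cbd_sum _ bxm)].
apply: (le_trans (normc_cint rho _ (bmf_cst (4 * (1 / 2) ^+ J)) _)).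
- apply: ccontD; first exact: ccont_pker.
  by apply: ccontN; exact: (ccont_sum _ cxm).
- by move=> t; exact: pker_expansion.
- by rewrite int_cst mulrA -natrM.
Qed.

End KernelExpansion.

Lemma half_expn_small (R : realType) (c d : R) : 0 < d ->
  exists J : nat, c * (1 / 2) ^+ J <= d.
Proof.
move=> d0.
have : (fun J => c * (1 / 2) ^+ J : R) @ \oo --> (c * 0).
  apply: cvgM; first exact: cvg_cst.
  by apply: cvg_expr; rewrite ger0_norm//; lra.
rewrite mulr0 => /cvgrPdist_le /(_ _ d0)[J _ /(_ J (leqnn J))].
by rewrite /= sub0r normrN => h; exists J; exact: le_trans (ler_norm _) h.
Qed.

Section TameTransforms.
Variables (R : realType) (V : nat -> finType) (E : forall n, rel (V n)).
Variables (bp : nat -> prob R) (mu : prob R).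
Hypothesis bp_cvg : weak_cvg bp mu.
Implicit Types (x : forall n, V n -> C R).
Local Notation iy y := (complex.Complex 0 y : C R).

Lemma tameN x : tame E x -> tame E (fun n v => - x n v).
Proof.
move=> tx; apply: (tame_ext (tameM (tame_cst E (ccvg_cst (-1))) tx)) => n v.
by rewrite mulN1r.
Qed.

Lemma tame_ptrans (y : R) x : 0 < y -> tame E x ->
  (\forall n \near \oo, forall v, normc (x n v) <= y / 8) ->
  tame E (fun n v => ptrans (bp n) (iy y - x n v)).
Proof.
move=> y0 tx xs; apply: tame_lim => d d0.
have [J HJ] := half_expn_small 8 d0.
exists (fun n v => \sum_(j < J) x n v ^+ j * cint (bp n) (axis_moment y j)).
  apply: (@tame_sum R V E J (fun j n v => x n v ^+ j * cint (bp n) (axis_moment y j))).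
  move=> j; apply: tameM; first exact: tameX.
  apply: tame_cst; apply: (ccvg_cint bp_cvg).
    exact: ccont_axis_moment.
  exact: cbd_axis_moment.
move: xs; apply: filterS => n h v; apply: le_trans HJ.
exact: ptrans_expansion.
Qed.

Lemma tame_V1D x : tame E x ->
  (\forall n \near \oo, forall v, normc (x n v) <= 1 / 2) ->
  tame E (fun n v => (1 + x n v)^-1).
Proof.
move=> tx xs; apply: tame_lim => d d0.
have [J HJ] := half_expn_small 2 d0.
exists (fun n v => \sum_(j < J) (- x n v) ^+ j).
  apply: (@tame_sum R V E J (fun j n v => (- x n v) ^+ j)) => j.
  by apply: tameX; exact: tameN.
move: xs; apply: filterS => n h v; apply: le_trans HJ.
have h1 : 1 / 2 <= normc (1 + x n v).
  have := le_normc_dist 1 (- x n v); rewrite opprK complex.normcN normc1.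
  by have := h v; lra.
have x0 : 1 - - x n v != 0 by rewrite opprK -normc_gt0; lra.
rewrite -{1}[x n v]opprK geo_expansion// opprK normcM normcX complex.normcN mulrC.
rewrite ler_pM ?exprn_ge0 ?normc_ge0//; last by rewrite lerXn2r ?nnegrE ?normc_ge0.
rewrite normcV -[leRHS]invrK lef_pV2 ?posrE ?invr_gt0//; last by lra.
by rewrite -div1r.
Qed.

Lemma tame_Ktrans (y : R) x : 0 < y -> tame E x ->
  (\forall n \near \oo, forall v, normc (x n v) <= y / 8) ->
  (\forall n \near \oo, etheta (bp n) y <= 1 / 16) ->
  tame E (fun n v => Ktrans (bp n) (iy y - x n v)).
Proof.
move=> y0 tx xs es.
have tz : tame E (fun n v => iy y - x n v).
  by apply: tameD; [exact: tame_cst (ccvg_cst (iy y))|exact: tameN].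
have tp := tame_ptrans y0 tx xs.
(* The quotient formula [KtransE] holds only for large n, so it is used as an eventual approximation
   with error 0. *)
apply: tame_lim => d d0.
exists (fun n v => (iy y - x n v) * ptrans (bp n) (iy y - x n v) *
  (1 + ptrans (bp n) (iy y - x n v))^-1).
  apply: tameM; first exact: tameM.
  apply: tame_V1D => //; move: xs es; apply: filterS2 => n h1 h2 v.
  apply: le_trans (normc_ptrans _ (disc_shift y0 (h1 v))) _; lra.
move: xs es; apply: filterS2 => n h1 h2 v.
by rewrite (KtransE h2 (disc_shift y0 (h1 v))) subrr normc0 ltW.
Qed.

End TameTransforms.

(** * Convergence of the K-transforms of the convolutions *)

Section KtransConvergence.
Variables (R : realType) (V : nat -> finType) (E : forall n, rel (V n)).
Variables (m bp conv : nat -> prob R) (mu : prob R) (nu : forall n, V n -> prob R).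
Local Notation iy y := (complex.Complex 0 y : C R).
Hypothesis V_gt0 : \forall n \near \oo, (0 < #|V n|)%N.
Hypothesis densities : forall t, exists l : R,
  (fun n => hom_density R (@gedge t) (@E n)) @ \oo --> l.
Hypothesis bpE : forall n, is_boolean_power (m n) #|V n| (bp n).
Hypothesis bp_cvg : weak_cvg bp mu.
Hypothesis nuE : forall n v z, upper z -> Ktrans (nu v) z =
  Ktrans (m n) (z - \sum_(w | @E n v w) Ktrans (nu w) z).
Hypothesis convE : forall n z, upper z ->
  Ktrans (conv n) z = \sum_(v : V n) Ktrans (nu v) z.

Let g (y : R) n (v : V n) : C R := #|V n|%:R * Ktrans (nu v) (iy y).

Let g_small (eps : R) : 0 < eps -> eps <= 1 / 1000 -> exists2 M, 0 < M &
  \forall n \near \oo, forall (y : R) v, M <= y -> normc (@g y n v) <= 32 * y * eps.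
Proof.
move=> eps0 eps1; have [M M0 HM] := etheta_near bp_cvg eps0.
exists M => //; move: HM V_gt0; apply: filterS2 => n h N0 y v My.
exact: (fixed_point_small N0 (bpE n) (@nuE n) M0 eps1 h).
Qed.

Let conv_avg n (y : R) : 0 < y -> (0 < #|V n|)%N ->
  Ktrans (conv n) (iy y) = avg (@g y n).
Proof.
move=> y0 N0; have n0 : (#|V n|%:R : C R) != 0 by rewrite pnatr_eq0 -lt0n.
by rewrite convE// /avg /g -mulr_sumr mulrAC divff ?mul1r.
Qed.

(** Uniformity in n makes this tightness of the convolutions in disguise, through
    [int_tail_Ktrans]. *)
Lemma Ktrans_conv_small (eps : R) : 0 < eps -> exists2 M, 0 < M &
  \forall n \near \oo, forall y : R, M <= y -> normc (Ktrans (conv n) (iy y)) <= y * eps.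
Proof.
(* eps/32 absorbs the constant of [fixed_point_small], and 1/1000 is the threshold it requires. *)
move=> eps0; pose eps' := Num.min (eps / 32) (1 / 1000).
have e0 : 0 < eps' by rewrite /eps' lt_min; apply/andP; split; lra.
have e1 : eps' <= 1 / 1000 by rewrite /eps' ge_min lexx orbT.
have e2 : eps' <= eps / 32 by rewrite /eps' ge_min lexx.
have [M M0 HM] := g_small e0 e1; exists M => //.
move: HM V_gt0; apply: filterS2 => n h N0 y My.
have y0 := lt_le_trans M0 My; rewrite conv_avg//.
have ye : y * eps' <= y * (eps / 32) by rewrite ler_wpM2l// ltW.
apply: normc_avg => [|w]; first by rewrite mulr_ge0// ltW.
by apply: le_trans (h y w My) _; lra.
Qed.

Let iterate (y : R) := fix h (k : nat) n (v : V n) : C R :=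
  if k is k'.+1 then Ktrans (bp n) (iy y - outavg (@E n) (h k' n) v) else 0.

Let iterate_small (y : R) k n v : 0 < y -> etheta (bp n) y <= 1 / 1000 ->
  normc (@iterate y k n v) <= y / 8.
Proof.
move=> y0 es; elim: k v => [|k IH] v /=.
  by rewrite (_ : Num.sqrt _ = normc (0 : C R))// normc0 divr_ge0// ltW.
have d : disc y (iy y - outavg (@E n) (@iterate y k n) v).
  by apply: disc_shift => //; apply: normc_outavg.
have es' : etheta (bp n) y <= 1 / 16 by lra.
apply: le_trans (normc_Ktrans es' d) _.
have : y * etheta (bp n) y <= y * (1 / 1000) by rewrite ler_wpM2l// ltW.
by lra.
Qed.

Let tame_iterate (y : R) k : 0 < y ->
  (\forall n \near \oo, etheta (bp n) y <= 1 / 1000) -> tame E (@iterate y k).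
Proof.
move=> y0 es; elim: k => [|k IH]; first exact: tame_cst (ccvg_cst 0).
apply: (@tame_Ktrans R V E bp mu bp_cvg y
  (fun n v => outavg (@E n) (@iterate y k n) v) y0).
- exact: tame_outavg.
- move: es; apply: filterS => n es v.
  by apply: normc_outavg => w; exact: iterate_small.
- by move: es; apply: filterS => n; lra.
Qed.

Let iterate_near (y : R) k n v : 0 < y -> (0 < #|V n|)%N ->
  etheta (bp n) y <= 1 / 1000 -> (forall w, normc (@g y n w) <= y / 8) ->
  normc (@g y n v - @iterate y k n v) <= y * (1 / 2) ^+ k.
Proof.
move=> y0 N0 es gs; elim: k v => [|k IH] v /=.
  by rewrite subr0 expr0 mulr1; have := gs v; lra.
have d1 : disc y (iy y - outavg (@E n) (@g y n) v).
  by apply: disc_shift => //; apply: normc_outavg.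
have d2 : disc y (iy y - outavg (@E n) (@iterate y k n) v).
  by apply: disc_shift => //; apply: normc_outavg => w; exact: iterate_small.
have es' : etheta (bp n) y <= 1 / 16 by lra.
have -> : @g y n v = Ktrans (bp n) (iy y - outavg (@E n) (@g y n) v).
  apply: (fixed_point_eq N0 (bpE n) (@nuE n)) => //.
  by apply: (@le_trans _ _ (y / 8)); [exact: normc_outavg|lra].
(* Contraction: 272/1000 is below 1/2, and [outavg] does not increase the maximum norm. *)
apply: le_trans (Ktrans_lip es' d1 d2) _.
rewrite [X in normc X](_ : _ = outavg (@E n) (@iterate y k n) v -
  outavg (@E n) (@g y n) v); last by ring.
rewrite normc_distC outavgB.
have h := @normc_outavg R (V n) (@E n) _ _ v IH.
have -> : y * (1 / 2) ^+ k.+1 = (1 / 2) * (y * (1 / 2) ^+ k) by rewrite exprS; ring.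
by rewrite ler_pM ?mulr_ge0 ?normc_ge0 ?etheta_ge0//; lra.
Qed.

Lemma Ktrans_conv_cvg : exists2 M, 0 < M & forall y : R, M <= y ->
  exists l, ccvg (fun n => Ktrans (conv n) (iy y)) l.
Proof.
have e0 : 0 < 1 / 1000 :> R by lra.
have [M1 M10 HM1] := g_small e0 (lexx _).
have [M2 M20 HM2] := etheta_near bp_cvg e0.
exists (Num.max M1 M2); first by rewrite lt_max M10.
move=> y; rewrite ge_max => /andP[y1 y2]; have y0 := lt_le_trans M10 y1.
have es : \forall n \near \oo, etheta (bp n) y <= 1 / 1000.
  by move: HM2; apply: filterS => n; apply: le_trans; exact: etheta_nincr.
have tg : tame E (@g y).
  apply: tame_lim => d d0; have [k Hk] := half_expn_small y d0.
  exists (@iterate y k); first exact: tame_iterate.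
  move: HM1 V_gt0 es; apply: filterS3 => n h1 N0 h3 v.
  apply: le_trans Hk; apply: iterate_near => // w.
  by apply: le_trans (h1 y w y1) _; lra.
have [l Hl] := tame_avg V_gt0 densities tg.
exists l => d d0; move: (Hl d d0) V_gt0; apply: filterS2 => n h N0.
by rewrite conv_avg.
Qed.

End KtransConvergence.

(** * Real integrals against resolvents *)

Section AxisIntegrals.
Variable R : realType.
Implicit Types (rho : prob R) (y a t : R).
Local Notation iy y := (complex.Complex 0 y : C R).

(** The boolean is the degree of the numerator. For a = y^2 the integrals give, up to sign and a
    factor y, the real (i = true) and imaginary (i = false) parts of the Cauchy transform at iy. *)
Definition res a (i : bool) t : R := t ^+ i / (t ^+ 2 + a).

Lemma res_den a t : 0 < a -> 0 < t ^+ 2 + a.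
Proof. by move=> a0; rewrite ltr_wpDl ?sqr_ge0. Qed.

Lemma norm_res_le1 a i t : 1 <= a -> `|res a i t| <= 1.
Proof.
move=> a1; have D0 := res_den t (lt_le_trans ltr01 a1).
rewrite /res normrM normfV (gtr0_norm D0) ler_pdivrMr// mul1r.
apply: (@le_trans _ _ (t ^+ 2 + 1)); last by rewrite lerD2l.
rewrite -[t ^+ 2]real_normK ?num_real//; case: i => /=.
  by rewrite expr1; move: (`|t|) (normr_ge0 t) => u u0; nra.
by rewrite expr0 normr1 lerDr sqr_ge0.
Qed.

Lemma continuous_res a i : 0 < a -> continuous (res a i).
Proof.
move=> a0 t; apply: cvgM.
  by case: i => /=; [exact: cvg_id|exact: cvg_cst].
apply: cvgV; first by rewrite gt_eqF// res_den.
by apply: cvgD; [apply: (cvgM _ _); exact: cvg_id|exact: cvg_cst].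
Qed.

Lemma bmf_res a i : 1 <= a -> bmf (res a i).
Proof.
move=> a1; apply: (bmf_continuous (M := 1)).
  exact: continuous_res (lt_le_trans ltr01 a1).
by move=> t; exact: norm_res_le1.
Qed.

(** Comparable to [theta] as a measure of tails, but its integral can be read off the Cauchy
    transform: it is Re (1 - iy G(iy)). *)
Definition tail y t : R := t ^+ 2 / (t ^+ 2 + y ^+ 2).

Lemma tail_ge0 y t : 0 < y -> 0 <= tail y t.
Proof. by move=> y0; rewrite divr_ge0 ?sqr_ge0// ltW// res_den// exprn_gt0. Qed.

Lemma tail_le1 y t : 0 < y -> tail y t <= 1.
Proof.
by move=> y0; rewrite ler_pdivrMr ?res_den ?exprn_gt0// mul1r lerDl sqr_ge0.
Qed.

Lemma bmf_tail y : 0 < y -> bmf (tail y).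
Proof.
move=> y0; apply: (bmf_continuous (M := 1)).
  move=> t; apply: cvgM; first by apply: (cvgM _ _); exact: cvg_id.
  apply: cvgV; first by rewrite gt_eqF// res_den// exprn_gt0.
  by apply: cvgD; [apply: (cvgM _ _); exact: cvg_id|exact: cvg_cst].
by move=> t; rewrite ger0_norm ?tail_ge0 ?tail_le1.
Qed.

Lemma tail_ge_half y t : 0 < y -> y <= `|t| -> 1 <= 2 * tail y t.
Proof.
move=> y0 yt; rewrite /tail mulrA ler_pdivlMr ?res_den ?exprn_gt0// mul1r.
have : y ^+ 2 <= `|t| ^+ 2 by rewrite lerXn2r ?nnegrE// ltW.
by rewrite real_normK ?num_real//; lra.
Qed.

Lemma tail_theta y t : 0 < y -> tail y t <= 2 * theta y t.
Proof.
move=> y0; have [yt|ty] := lerP y `|t|.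
  apply: le_trans (tail_le1 t y0) _.
  by rewrite /theta mulrA ler_pdivlMr ?theta_den//; lra.
rewrite /theta mulrA ler_pdivlMr ?theta_den// /tail mulrAC ler_pdivrMr ?res_den ?exprn_gt0//.
rewrite -[t ^+ 2]real_normK ?num_real//.
move: (`|t|) (normr_ge0 t) ty => u u0 uy.
have h : 0 <= u * (u ^+ 2 + 2 * y ^+ 2 - u * y).
  rewrite mulr_ge0//; nra.
by nra.
Qed.

Lemma int_tail_cvg0 rho (e : R) : 0 < e ->
  exists2 M, 0 < M & forall y, M <= y -> Rintegral rho setT (tail y) <= e.
Proof.
move=> e0; have e20 : 0 < e / 2 by rewrite divr_gt0.
have [M M0 HM] := etheta_cvg0 rho e20; exists M => // y My.
have y0 := lt_le_trans M0 My.
apply: (@le_trans _ _ (Rintegral rho setT (fun t => 2 * theta y t))).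
  apply: le_int; [exact: bmf_tail|apply: bmfZ; exact: bmf_theta|move=> t].
  exact: tail_theta.
by rewrite intZ; [rewrite -/(etheta rho y); have := HM y My; lra|exact: bmf_theta].
Qed.

Lemma Re_cauchy_axis rho y : 1 <= y ->
  Re (cauchy rho (iy y)) = - Rintegral rho setT (res (y ^+ 2) true).
Proof.
move=> y1; have y21 : 1 <= y ^+ 2 by rewrite expr_ge1// (le_trans ler01).
rewrite -mulN1r -intZ; last exact: bmf_res.
by congr Rintegral; apply/funext => t; rewrite /= sub0r sqrrN /res /= mulN1r mulNr.
Qed.

Lemma Im_cauchy_axis rho y : 1 <= y ->
  Im (cauchy rho (iy y)) = - y * Rintegral rho setT (res (y ^+ 2) false).
Proof.
move=> y1; have y21 : 1 <= y ^+ 2 by rewrite expr_ge1// (le_trans ler01).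
rewrite -intZ; last exact: bmf_res.
by congr Rintegral; apply/funext => t; rewrite /= sub0r sqrrN /res /= expr0 mul1r.
Qed.

Lemma cauchyK rho y : cauchy rho (iy y) = (iy y - Ktrans rho (iy y))^-1.
Proof. by rewrite /Ktrans opprB addrC subrK invrK. Qed.

Lemma normc_axisB y (k : C R) : 0 < y -> normc k <= y / 2 -> y / 2 <= normc (iy y - k).
Proof.
move=> y0 ky; have := le_normc_dist (iy y) k.
have -> : normc (iy y) = y by rewrite /= expr0n /= add0r sqrtr_sqr gtr0_norm.
by move: ky; lra.
Qed.

(** With G = 1/(iy - K) one has 1 - iy G(iy) = -K/(iy - K), whose denominator is at least y/2 in
    modulus. *)
Lemma int_tail_Ktrans rho y (eps : R) : 1 <= y -> eps <= 1 / 2 ->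
  normc (Ktrans rho (iy y)) <= y * eps ->
  Rintegral rho setT (tail y) <= 2 * eps.
Proof.
move=> y1 eps1 Ky; have y0 := lt_le_trans ltr01 y1.
have y21 : 1 <= y ^+ 2 by rewrite expr_ge1// (le_trans ler01).
have eps0 : 0 <= eps.
  by have := le_trans (normc_ge0 _) Ky; rewrite pmulr_rge0.
have K2 : normc (Ktrans rho (iy y)) <= y / 2.
  apply: le_trans Ky _; have : y * eps <= y * (1 / 2) by rewrite ler_wpM2l// ltW.
  by lra.
have d2 := normc_axisB y0 K2.
have n0 : iy y - Ktrans rho (iy y) != 0.
  by rewrite -normc_gt0; apply: lt_le_trans d2; rewrite divr_gt0.
have -> : Rintegral rho setT (tail y) = Re (1 - iy y * cauchy rho (iy y)).
  transitivity (1 + y * Im (cauchy rho (iy y))).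
    rewrite Im_cauchy_axis// mulrA mulrN mulNr -intZ; last exact: bmf_res.
    rewrite -[in RHS](int_cst rho 1) -intB; [|exact: bmf_cst|apply: bmfZ; exact: bmf_res].
    congr Rintegral; apply/funext => t; rewrite /tail /res /= expr0.
    by field; rewrite gt_eqF// res_den// exprn_gt0.
  by case: (cauchy rho (iy y)) => a b /=; rewrite mul0r sub0r opprK.
have -> : 1 - iy y * cauchy rho (iy y) =
    - (Ktrans rho (iy y) * (iy y - Ktrans rho (iy y))^-1).
  by rewrite cauchyK; field.
apply: le_trans (ler_norm _) _; apply: le_trans (le_normc_Re _) _.
rewrite complex.normcN normcM normcV ler_pdivrMr; last by apply: lt_le_trans d2; rewrite divr_gt0.
apply: le_trans Ky _.
have : 2 * eps * (y / 2) <= 2 * eps * normc (iy y - Ktrans rho (iy y)).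
  by rewrite ler_wpM2l// mulr_ge0.
by apply: le_trans; lra.
Qed.

End AxisIntegrals.

Lemma ccvg_Re (R : realType) (u : nat -> C R) l : ccvg u l ->
  (fun n => Re (u n)) @ \oo --> Re l.
Proof.
move=> h; apply/cvgrPdist_le => e e0; move: (h e e0); apply: filterS => n.
by rewrite normc_distC; apply: le_trans; exact: Re_lip.
Qed.

Lemma ccvg_Im (R : realType) (u : nat -> C R) l : ccvg u l ->
  (fun n => Im (u n)) @ \oo --> Im l.
Proof.
move=> h; apply/cvgrPdist_le => e e0; move: (h e e0); apply: filterS => n.
by rewrite normc_distC; apply: le_trans; exact: Im_lip.
Qed.

Section AxisLimits.
Variables (R : realType) (rho : nat -> prob R).
Local Notation iy y := (complex.Complex 0 y : C R).

Lemma ccvg_cauchy_axis (y : R) l : 0 < y ->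
  (\forall n \near \oo, normc (Ktrans (rho n) (iy y)) <= y * (1 / 4)) ->
  ccvg (fun n => Ktrans (rho n) (iy y)) l ->
  ccvg (fun n => cauchy (rho n) (iy y)) (iy y - l)^-1.
Proof.
move=> y0 Ks Kl.
(* The bound y/4 on the sequence and an error y/4 at a single index; so the limiting denominator iy
   - l also stays away from 0. *)
have l2 : normc l <= y / 2.
  have y40 : 0 < y / 4 by rewrite divr_gt0.
  have [n [h1 h2]] := @filter_ex _ \oo _ _ (filterI Ks (Kl _ y40)).
  have := le_normcB (Ktrans (rho n) (iy y)) (Ktrans (rho n) (iy y) - l).
  by rewrite opprB addrC subrK; lra.
have dl := normc_axisB y0 l2.
move=> e e0.
have y20 : 0 < y / 2 by rewrite divr_gt0.
have e'0 : 0 < e * (y / 2) ^+ 2 by rewrite mulr_gt0// exprn_gt0.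
move: Ks (Kl _ e'0); apply: filterS2 => n h1 h2.
have K2 : normc (Ktrans (rho n) (iy y)) <= y / 2 by lra.
have dn := normc_axisB y0 K2; rewrite cauchyK.
have h3 : normc ((iy y - l) - (iy y - Ktrans (rho n) (iy y))) <= e * (y / 2) ^+ 2.
  apply: le_trans h2; rewrite le_eqVlt; apply/orP; left; apply/eqP.
  by congr normc; ring.
move: (iy y - l) (iy y - Ktrans _ _) dl dn h3 => b a bl an ba.
have a0 : a != 0 by rewrite -normc_gt0; lra.
have b0 : b != 0 by rewrite -normc_gt0; lra.
have -> : a^-1 - b^-1 = (b - a) * (a * b)^-1 by field; rewrite a0 b0.
rewrite normcM normcV normcM ler_pdivrMr; last by rewrite mulr_gt0; lra.
apply: le_trans ba _; rewrite ler_wpM2l ?(ltW e0)// expr2 ler_pM ?(ltW y20)//.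
Qed.

Lemma cvgn_res (M : R) : 1 <= M ->
  (forall y, M <= y -> exists l, ccvg (fun n => Ktrans (rho n) (iy y)) l) ->
  (\forall n \near \oo, forall y, M <= y ->
     normc (Ktrans (rho n) (iy y)) <= y * (1 / 4)) ->
  forall a i, M ^+ 2 <= a -> cvgn (fun n => Rintegral (rho n) setT (res a i)).
Proof.
move=> M1 Kl Ks a i Ma.
have M0 : 0 <= M by rewrite (le_trans ler01).
have a0 : 0 <= a by apply: le_trans Ma; rewrite sqr_ge0.
pose y := Num.sqrt a.
have My : M <= y by rewrite /y -(ger0_norm M0) -sqrtr_sqr ler_wsqrtr.
have y1 := le_trans M1 My; have y0 := lt_le_trans ltr01 y1.
have ay : a = y ^+ 2 by rewrite sqr_sqrtr.
have [l Hl] := Kl y My.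
have Ks' : \forall n \near \oo, normc (Ktrans (rho n) (iy y)) <= y * (1 / 4).
  by move: Ks; apply: filterS => n; exact.
have Hc := ccvg_cauchy_axis y0 Ks' Hl.
rewrite ay; case: i.
  have -> : (fun n => Rintegral (rho n) setT (res (y ^+ 2) true)) =
            (fun n => - Re (cauchy (rho n) (iy y))).
    by apply/funext => n; rewrite Re_cauchy_axis// opprK.
  by apply/cvg_ex; exists (- Re (iy y - l)^-1); apply: cvgN; exact: ccvg_Re.
have -> : (fun n => Rintegral (rho n) setT (res (y ^+ 2) false)) =
          (fun n => (- y)^-1 * Im (cauchy (rho n) (iy y))).
  apply/funext => n; rewrite Im_cauchy_axis// mulKf// oppr_eq0 gt_eqF//.
apply/cvg_ex; exists ((- y)^-1 * Im (iy y - l)^-1); apply: cvgM; first exact: cvg_cst.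
exact: ccvg_Im.
Qed.

End AxisLimits.

(** * The function algebra generated by the resolvents *)

Section ResolventAlgebra.
Variables (R : realType) (a0 : R).
Hypothesis a0_ge1 : 1 <= a0.
Implicit Types f g : R -> R.

(* The premise [bmf f] of [ralg_lim] spares the measurability of a limit. *)
Inductive ralg : (R -> R) -> Prop :=
| ralg_cst c : ralg (fun=> c)
| ralg_res a i : a0 <= a -> ralg (res a i)
| ralg_lin c f g : ralg f -> ralg g -> ralg (fun t => c * f t + g t)
| ralg_lim f (g : R -> R -> R) : bmf f -> (forall e, 0 < e -> ralg (g e)) ->
    (forall e t, 0 < e -> `|f t - g e t| <= e) -> ralg f.

Lemma ralg_bmf f : ralg f -> bmf f.
Proof.
elim=> {f} [c|a i aa|c f g _ bf _ bg|//]; first exact: bmf_cst.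
- exact: bmf_res (le_trans a0_ge1 aa).
- by apply: bmfD => //; exact: bmfZ.
Qed.

Lemma ralgZ c f : ralg f -> ralg (fun t => c * f t).
Proof.
move=> rf; have := ralg_lin c rf (ralg_cst 0).
by congr ralg; apply/funext => t; rewrite addr0.
Qed.

Lemma ralgD f g : ralg f -> ralg g -> ralg (fun t => f t + g t).
Proof.
move=> rf rg; have := ralg_lin 1 rf rg.
by congr ralg; apply/funext => t; rewrite mul1r.
Qed.

Lemma ralgB f g : ralg f -> ralg g -> ralg (fun t => f t - g t).
Proof.
move=> rf rg; have := ralg_lin (-1) rg rf.
by congr ralg; apply/funext => t; rewrite mulN1r addrC.
Qed.

(* Partial fractions, for distinct poles. *)
Lemma ralg_res_res_neq a b i j : a0 <= a -> a0 <= b -> a != b ->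
  ralg (fun t => res a i t * res b j t).
Proof.
move=> aa ab ab0.
have ba0 : b - a != 0 by rewrite subr_eq0 eq_sym.
have D c t : a0 <= c -> t ^+ 2 + c != 0.
  by move=> ac; rewrite gt_eqF// res_den// (lt_le_trans ltr01)// (le_trans a0_ge1).
have E1 : ralg (fun t => (b - a)^-1 * (res a (i (+) j) t - res b (i (+) j) t)).
  by apply: ralgZ; apply: ralgB; exact: ralg_res.
(* For i = j = true the numerator is t^2, which i (+) j does not represent; this is the
   decomposition for that case. *)
have E2 : ralg (fun t => (b - a)^-1 * (b * res b false t - a * res a false t)).
  by apply: ralgZ; apply: ralgB; apply: ralgZ; exact: ralg_res.
case: i j E1 => -[] E1.
- move: E2; congr ralg; apply/funext => t; rewrite /res /=.
  by field; rewrite ba0 !D.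
- move: E1; congr ralg; apply/funext => t; rewrite /res /=.
  by field; rewrite ba0 !D.
- move: E1; congr ralg; apply/funext => t; rewrite /res /=.
  by field; rewrite ba0 !D.
- move: E1; congr ralg; apply/funext => t; rewrite /res /=.
  by field; rewrite ba0 !D.
Qed.

(** A double pole is a uniform limit of products with distinct poles: replacing a by a + e in one
    factor changes the product by at most e. *)
Lemma ralg_res_res a b i j : a0 <= a -> a0 <= b ->
  ralg (fun t => res a i t * res b j t).
Proof.
move=> aa ab; have [<-|] := eqVneq a b; last exact: ralg_res_res_neq.
have a1 := le_trans a0_ge1 aa.
apply: (@ralg_lim _ (fun e t => res a i t * res (a + e) j t)).
- by apply: bmfM; exact: bmf_res.
- move=> e e0; apply: ralg_res_res_neq => //; first by rewrite ler_wpDr// ltW.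
  by rewrite -subr_eq0 opprD addNKr oppr_eq0 gt_eqF.
move=> e t e0; rewrite -mulrBr normrM.
have D0 : 0 < t ^+ 2 + a by rewrite res_den// (lt_le_trans ltr01).
have De0 : 0 < t ^+ 2 + (a + e) by rewrite addrA addr_gt0.
have -> : res a j t - res (a + e) j t = e / (t ^+ 2 + (a + e)) * res a j t.
  by rewrite /res; field; rewrite !gt_eqF.
have q0 : 0 <= e / (t ^+ 2 + (a + e)) by rewrite divr_ge0 ?(ltW e0) ?(ltW De0).
have qe : e / (t ^+ 2 + (a + e)) <= e.
  rewrite ler_pdivrMr// ler_pMr//.
  by rewrite -[leLHS]add0r lerD ?sqr_ge0//; lra.
have r1 := norm_res_le1 i t a1; have r2 := norm_res_le1 j t a1.
rewrite [X in _ * X]normrM mulrCA (ger0_norm q0) -[leRHS]mulr1.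
by apply: ler_pM => //; exact: mulr_ile1.
Qed.

Lemma ralg_limM f (g : R -> R -> R) h : bmf f -> bmf h ->
  (forall e, 0 < e -> ralg (fun t => g e t * h t)) ->
  (forall e t, 0 < e -> `|f t - g e t| <= e) -> ralg (fun t => f t * h t).
Proof.
move=> bf bh rg fg; have [_ [M hM]] := bh.
have M0 : 0 < `|M| + 1 by rewrite ltr_wpDl.
apply: (@ralg_lim _ (fun e t => g (e / (`|M| + 1)) t * h t)).
- exact: bmfM.
- by move=> e e0; apply: rg; rewrite divr_gt0.
move=> e t e0; rewrite -mulrBl normrM.
rewrite [leRHS](_ : e = e / (`|M| + 1) * (`|M| + 1)); last by rewrite divfK// gt_eqF.
rewrite ler_pM//; first by apply: fg; rewrite divr_gt0.
by apply: le_trans (hM t) _; have := ler_norm M; lra.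
Qed.

(** Closure under products takes two inductions: here one factor is a generator, and [ralgM] then
    inducts on that factor. *)
Lemma ralg_resM a i g : a0 <= a -> ralg g -> ralg (fun t => res a i t * g t).
Proof.
move=> aa; elim=> {g} [c|b j ab|c f g _ rf _ rg|f g bf rg rM fg].
- under eq_fun do rewrite mulrC; apply: ralgZ; exact: ralg_res.
- exact: ralg_res_res.
- by under eq_fun do rewrite mulrDr mulrCA; exact: ralg_lin.
- under eq_fun do rewrite mulrC; apply: ralg_limM fg => //.
    exact: bmf_res (le_trans a0_ge1 aa).
  by move=> e e0; under eq_fun do rewrite mulrC; exact: rM.
Qed.

Lemma ralgM f g : ralg f -> ralg g -> ralg (fun t => f t * g t).
Proof.
move=> rf rg; elim: rf => {f} [c|b j ab|c f h _ rf _ rh|f h bf _ rM fh].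
- exact: ralgZ.
- exact: ralg_resM.
- by under eq_fun do rewrite mulrDl -mulrA; exact: ralg_lin.
- by apply: ralg_limM fh => //; exact: ralg_bmf.
Qed.

(* The iteration u <- u + (x^2 - u^2)/2 increases from 0 to |x|. *)
Fixpoint abs_iter (f : R -> R) (k : nat) (t : R) : R :=
  if k is k'.+1
  then abs_iter f k' t + 2^-1 * (f t * f t - abs_iter f k' t * abs_iter f k' t)
  else 0.

Lemma ralg_abs_iter f k : ralg f -> ralg (abs_iter f k).
Proof.
move=> rf; elim: k => [|k IH]; first exact: ralg_cst.
by apply: ralgD => //; apply: ralgZ; apply: ralgB; exact: ralgM.
Qed.

(** The error r = |x| - u is multiplied by 1 - (|x| + u)/2, at most 1 - r/2. If r m <= 2, then r (1
    - r/2)(m + 1) <= (2 + r)(1 - r/2) <= 2, whence the rate 2/m, uniform in t. *)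
Lemma abs_iterP f k t : `|f t| <= 1 ->
  0 <= abs_iter f k t <= `|f t| /\ `|f t| - abs_iter f k t <= 2 / k.+2%:R.
Proof.
move=> f1; elim: k => [|k [/andP[u0 uf] IH]] /=.
  by rewrite lexx normr_ge0 subr0 divff ?pnatr_eq0.
have -> : f t * f t = `|f t| * `|f t| by rewrite -expr2 -real_normK ?num_real.
move: (abs_iter f k t) (`|f t|) (normr_ge0 (f t)) f1 u0 uf IH => u x x0 x1 u0 ux.
have n0 : 0 < k.+2%:R :> R by [].
have n30 : 0 < k.+3%:R :> R by [].
have n3 : k.+3%:R = k.+2%:R + 1 :> R by rewrite -natr1.
rewrite n3 in n30 *; have n2 : 2 <= k.+2%:R :> R by rewrite ler_nat.
move: (k.+2%:R : R) n0 n30 n2 => m n0 n30 n2.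
rewrite ler_pdivlMr// => IH; split.
  by apply/andP; split; nra.
rewrite ler_pdivlMr//.
have r0 : 0 <= x - u by lra.
have : x - (u + 2^-1 * (x * x - u * u)) <= (x - u) * (1 - (x - u) / 2) by nra.
move: (x - u) r0 IH => r r0 IH h.
have r1 : r <= 1 by nra.
have : (r * (1 - r / 2)) * (m + 1) <= 2.
  have : 0 <= (2 - r * m) by lra.
  nra.
nra.
Qed.

Lemma ralg_norm_le1 f : ralg f -> (forall t, `|f t| <= 1) -> ralg (fun t => `|f t|).
Proof.
move=> rf f1.
have h (e : R) : exists k : nat, 0 < e -> 2 / k.+2%:R <= e.
  have [e0|] := ltrP 0 e; last by exists 0%N; lra.
  exists (Num.bound (2 / e)) => _.
  rewrite ler_pdivrMr// mulrC -ler_pdivrMr//.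
  have : 2 / e < (Num.bound (2 / e))%:R.
    by apply: archi_boundP; rewrite divr_ge0// ltW.
  move=> /ltW /le_trans; apply; rewrite ler_nat; lia.
have [K HK] := choice h.
apply: (@ralg_lim _ (fun e => abs_iter f (K e))).
- by apply: bmf_norm; exact: ralg_bmf.
- by move=> e _; exact: ralg_abs_iter.
move=> e t e0; have [/andP[u0 uf] H] := abs_iterP (K e) (f1 t).
by rewrite ger0_norm ?subr_ge0//; exact: le_trans H (HK e e0).
Qed.

Lemma ralg_norm f : ralg f -> ralg (fun t => `|f t|).
Proof.
move=> rf; have [_ [M fM]] := ralg_bmf rf.
have M0 : 0 < `|M| + 1 by rewrite ltr_wpDl.
have : ralg (fun t => `|(`|M| + 1)^-1 * f t|).
  apply: ralg_norm_le1 => [|t]; first exact: ralgZ.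
  rewrite normrM gtr0_norm ?invr_gt0// mulrC ler_pdivrMr// mul1r.
  by apply: le_trans (fM t) _; have := ler_norm M; lra.
move=> /(ralgZ (`|M| + 1)); congr ralg; apply/funext => t.
by rewrite normrM gtr0_norm ?invr_gt0// mulVKf// gt_eqF.
Qed.

End ResolventAlgebra.

(** * Ramp functions *)

Section Ramps.
Variable R : realType.
Implicit Types (a b s t : R).

(** Truncation of s to [0, 1], written with absolute values so that closure of [ralg] under them
    applies. *)
Definition clip s : R := 2^-1 * (`|s| - `|s - 1| + 1).

Lemma clip_le0 s : s <= 0 -> clip s = 0.
Proof. by move=> s0; rewrite /clip !ler0_norm; lra. Qed.

Lemma clip_ge1 s : 1 <= s -> clip s = 1.
Proof. by move=> s0; rewrite /clip !ger0_norm; lra. Qed.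

Lemma clip_id s : 0 <= s <= 1 -> clip s = s.
Proof. by move=> /andP[s0 s1]; rewrite /clip ger0_norm// ler0_norm; lra. Qed.

Lemma clip_itv s : 0 <= clip s <= 1.
Proof.
have [/clip_le0->|s0] := lerP s 0; first by rewrite lexx ler01.
have [/clip_ge1->|s1] := lerP 1 s; first by rewrite lexx ler01.
by rewrite clip_id !ltW.
Qed.

Lemma clip_ge0 s : 0 <= clip s. Proof. by case/andP: (clip_itv s). Qed.

Lemma clip_le1 s : clip s <= 1. Proof. by case/andP: (clip_itv s). Qed.

Lemma clip_mono s t : s <= t -> clip s <= clip t.
Proof.
move=> st; have [/clip_le0->|s0] := lerP s 0; first exact: clip_ge0.
have [/clip_ge1->|t1] := lerP 1 t; first exact: clip_le1.
by rewrite !clip_id//; lra.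
Qed.

Lemma clip_lip s t : `|clip s - clip t| <= `|s - t|.
Proof.
wlog st : s t / s <= t => [h|].
  have [st|ts] := leP s t; first exact: (h s t st).
  by rewrite (distrC (clip s)) (distrC s); exact: (h t s (ltW ts)).
have cm := clip_mono st.
rewrite !ler0_norm ?subr_le0// {cm}.
have [s0|s0] := lerP s 0; have [t0|t0] := lerP t 0.
- by rewrite !clip_le0//; lra.
- rewrite (clip_le0 s0); have [t1|t1] := lerP 1 t; first by rewrite clip_ge1//; lra.
  by rewrite clip_id; lra.
- by lra.
- have [s1|s1] := lerP 1 s; first by rewrite !clip_ge1//; lra.
  rewrite (@clip_id s); last by lra.
  have [t1|t1] := lerP 1 t; first by rewrite clip_ge1//; lra.
  by rewrite clip_id; lra.
Qed.

(** For a < b this falls from 1 at a to 0 at b: a continuous stand-in for the indicator of a left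
    half-line. *)
Definition ramp a b t : R := clip ((b - t) / (b - a)).

Lemma ramp_ge0 a b t : 0 <= ramp a b t. Proof. exact: clip_ge0. Qed.

Lemma ramp_le1 a b t : ramp a b t <= 1. Proof. exact: clip_le1. Qed.

Lemma ramp_lip a b t t' : a < b -> `|ramp a b t - ramp a b t'| <= `|t - t'| / (b - a).
Proof.
move=> ab; apply: le_trans (clip_lip _ _) _; rewrite -mulrBl normrM.
rewrite (_ : b - t - (b - t') = - (t - t')); last by ring.
by rewrite normrN normfV (@gtr0_norm _ (b - a)) ?subr_gt0.
Qed.

Lemma ramp_eq1 a b t : a < b -> t <= a -> ramp a b t = 1.
Proof.
by move=> ab ta; rewrite /ramp clip_ge1// ler_pdivlMr ?subr_gt0//; lra.
Qed.

Lemma ramp_eq0 a b t : a < b -> b <= t -> ramp a b t = 0.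
Proof.
by move=> ab ta; rewrite /ramp clip_le0// ler_pdivrMr ?subr_gt0//; lra.
Qed.

Lemma continuous_ramp a b : a < b -> continuous (ramp a b).
Proof.
move=> ab t; apply/cvgrPdist_le => e e0.
have := @cvg_id _ (nbhs t) => /cvgrPdist_le /(_ (e * (b - a))).
rewrite mulr_gt0 ?subr_gt0// => /(_ isT); apply: filterS => t' h.
by apply: le_trans (ramp_lip _ _ ab) _; rewrite ler_pdivrMr ?subr_gt0.
Qed.

Lemma norm_ramp_le1 a b t : `|ramp a b t| <= 1.
Proof. by rewrite ger0_norm ?ramp_ge0 ?ramp_le1. Qed.

Lemma bmf_ramp a b : a < b -> bmf (ramp a b).
Proof.
move=> ab; apply: (bmf_continuous (M := 1)); first exact: continuous_ramp.
by move=> t; exact: norm_ramp_le1.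
Qed.

Lemma ramp_mono a b a' b' t : a < b -> a' < b' -> b <= a' ->
  ramp a b t <= ramp a' b' t.
Proof.
move=> ab ab' ba; have [tb|bt] := lerP b t; first by rewrite (ramp_eq0 ab tb) ramp_ge0.
by rewrite (ramp_eq1 ab') ?ramp_le1//; lra.
Qed.

Lemma ramp_shift a d c t : ramp (a + c) (a + d + c) t = ramp a (a + d) (t - c).
Proof. by rewrite /ramp; congr (clip (_ / _)); ring. Qed.

Lemma ralg_clip a0 (f : R -> R) : 1 <= a0 -> ralg a0 f -> ralg a0 (fun t => clip (f t)).
Proof.
move=> a01 rf; apply: ralgZ; apply: ralgD; last exact: ralg_cst.
apply: ralgB; first exact: ralg_norm.
by apply: ralg_norm => //; apply: ralgB => //; exact: ralg_cst.
Qed.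

End Ramps.

Section RampLimits.
Variables (R : realType) (rho : nat -> prob R) (a0 : R).
Hypothesis a0_ge1 : 1 <= a0.
Hypothesis res_cvg : forall a i, a0 <= a ->
  cvgn (fun n => Rintegral (rho n) setT (res a i)).
Hypothesis tight : forall e : R, 0 < e ->
  exists2 Y, 0 < Y & \forall n \near \oo, Rintegral (rho n) setT (tail Y) <= e.

Lemma cvgn_ralg f : ralg a0 f -> cvgn (fun n => Rintegral (rho n) setT f).
Proof.
elim=> {f} [c|a i|c f g rf cf rg cg|f g bf rg cg fg].
- by under eq_fun do rewrite int_cst; exact: is_cvg_cst.
- exact: res_cvg.
- have bf := ralg_bmf a0_ge1 rf; have bg := ralg_bmf a0_ge1 rg.
  have -> : (fun n => Rintegral (rho n) setT (fun t => c * f t + g t)) =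
    (fun n => c * Rintegral (rho n) setT f + Rintegral (rho n) setT g).
    by apply/funext => n; rewrite intD ?intZ//; exact: bmfZ.
  have /cvg_ex[lf Hf] := cf; have /cvg_ex[lg Hg] := cg.
  apply/cvg_ex; exists (c * lf + lg); apply: cvgD => //; apply: cvgM => //.
  exact: cvg_cst.
apply: real_cvg_approx => e e0; have e20 : 0 < e / 2 by rewrite divr_gt0.
have /cvg_ex[l /cvgrPdist_le /(_ _ e20) Hl] := cg _ e20.
exists l; move: Hl; apply: filterS => n hl.
have : `|Rintegral (rho n) setT f - Rintegral (rho n) setT (g (e / 2))| <= e / 2.
  rewrite -[leRHS](int_cst (rho n)); apply: norm_intB => //.
  - exact: ralg_bmf (rg _ e20).
  - exact: bmf_cst.
  - by move=> t; exact: fg.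
have := ler_distD (Rintegral (rho n) setT (g (e / 2))) (Rintegral (rho n) setT f) l.
by rewrite distrC in hl; lra.
Qed.

(** Members of [ralg] have the same limit at both infinities and a ramp does not, so it can be
    approximated only up to tails, which tightness controls. *)
Lemma cvgn_ramp a b : a < b -> cvgn (fun n => Rintegral (rho n) setT (ramp a b)).
Proof.
move=> ab; have ba0 : 0 < b - a by rewrite subr_gt0.
apply: real_cvg_approx => e e0.
have e20 : 0 < e / 2 by rewrite divr_gt0.
have e40 : 0 < e / 4 by rewrite divr_gt0.
have e80 : 0 < e / 8 by rewrite divr_gt0.
have [Y Y0 HY] := tight e80.
(* The bounded function A t/(t^2 + A) replaces t; it differs by |t|^3/(t^2 + A), at most Y^3/A on
   [-Y, Y]. With the tails the error is e/4 + 2 (e/8) = e/2. *)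
pose A := a0 + Y ^+ 3 / ((b - a) * (e / 4)).
have Y30 : 0 <= Y ^+ 3 / ((b - a) * (e / 4)).
  by apply: divr_ge0; [apply: exprn_ge0|apply: mulr_ge0]; exact: ltW.
have a0A : a0 <= A by rewrite lerDl.
have A0 : 0 < A by rewrite (lt_le_trans ltr01)// (le_trans a0_ge1).
have AY : Y ^+ 3 / A / (b - a) <= e / 4.
  rewrite ler_pdivrMr// ler_pdivrMr// -ler_pdivrMl ?mulr_gt0//.
  by rewrite mulrC [_ * (b - a)]mulrC /A lerDr (le_trans ler01).
pose g t := clip ((b - A * res A true t) / (b - a)).
have rg : ralg a0 g.
  apply: ralg_clip => //.
  under eq_fun do rewrite mulrC; apply: ralgZ; apply: ralgB; first exact: ralg_cst.
  by apply: ralgZ; exact: ralg_res.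
have bg := ralg_bmf a0_ge1 rg.
have /cvg_ex[l /cvgrPdist_le /(_ _ e20) Hl] := cvgn_ralg rg.
exists l; move: Hl HY; apply: filterS2 => n hl hY.
have bt : bmf (fun t => 2 * tail Y t) by apply: bmfZ; exact: bmf_tail.
have : `|Rintegral (rho n) setT (ramp a b) - Rintegral (rho n) setT g| <=
  Rintegral (rho n) setT (fun t => e / 4 + 2 * tail Y t).
  apply: norm_intB => //; [exact: bmf_ramp|apply: bmfD => //; exact: bmf_cst|].
  move=> t; have t0 := tail_ge0 t Y0.
  have [Yt|tY] := lerP Y `|t|.
    have := tail_ge_half Y0 Yt; have := ramp_ge0 a b t; have := ramp_le1 a b t.
    have := clip_ge0 ((b - A * res A true t) / (b - a)).
    have := clip_le1 ((b - A * res A true t) / (b - a)).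
    by rewrite -/(g t) ler_norml; lra.
  apply: (@le_trans _ _ (e / 4)); last by lra.
  apply: le_trans (clip_lip _ _) _; apply: le_trans AY.
  have D0 : 0 < t ^+ 2 + A by rewrite res_den.
  have -> : (b - t) / (b - a) - (b - A * res A true t) / (b - a) =
            - (t ^+ 3 / (t ^+ 2 + A) / (b - a)).
    by rewrite /res /=; field; rewrite !gt_eqF.
  rewrite normrN 2!normrM !normfV normrX (gtr0_norm D0) (gtr0_norm ba0).
  rewrite ler_wpM2r ?invr_ge0 ?(ltW ba0)//.
  rewrite ler_pM ?invr_ge0 ?(ltW D0)//.
    by rewrite lerXn2r ?nnegrE ?(ltW Y0) ?(ltW tY).
  by rewrite lef_pV2 ?posrE// lerDr sqr_ge0.
rewrite intD//; last exact: bmf_cst.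
rewrite int_cst intZ; last exact: bmf_tail.
have := ler_distD (Rintegral (rho n) setT g) (Rintegral (rho n) setT (ramp a b)) l.
by rewrite distrC in hl; lra.
Qed.

End RampLimits.

(** * The limit distribution function *)

Section ProbabilityOfCdf.
Local Open Scope measure_display_scope.
Variable R : realType.

(** The Stieltjes measure lives on [measurableTypeR R]; its law under the identity is the same
    measure as a probability on [R]. *)
Let idTR : measurableTypeR R -> R := idfun.

#[local] HB.instance Definition _ :=
  @isMeasurableFun.Build _ _ _ _ idTR (@measurable_id _ _ setT).

Lemma prob_of_cdf (F : R -> R) :
  nondecreasing F -> right_continuous F -> F @ -oo --> (0:R) -> F @ +oo --> (1:R) ->
  exists lam : prob R, forall x, lam `]-oo, x]%classic = (F x)%:E.
Proof.
move=> nd rc Ny y.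
pose c1 := isCumulative.Build R _ R F nd rc.
pose c2 := isCumulativeBounded.Build R 0 1 F Ny y.
pose F2 : cumulativeBounded (0:R) (1:R) := HB.pack F c1 c2.
pose X : {RV (lebesgue_stieltjes_measure F2) >-> R} := idTR.
pose lam : prob R := distribution (lebesgue_stieltjes_measure F2) X.
exists lam => x.
exact: (cdf_lebesgue_stieltjes_id F2 x).
Qed.
End ProbabilityOfCdf.

Section LimitCdf.
Variables (R : realType) (rho : nat -> prob R).
Hypothesis cvg_ramp : forall a b : R, a < b ->
  cvgn (fun n => Rintegral (rho n) setT (ramp a b)).
Hypothesis tight : forall e : R, 0 < e ->
  exists2 Y, 0 < Y & \forall n \near \oo, Rintegral (rho n) setT (tail Y) <= e.

Definition ramp_lim (a b : R) : R := limn (fun n => Rintegral (rho n) setT (ramp a b)).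

Local Notation L := ramp_lim.

Lemma ramp_lim_le (a b c : R) : a < b ->
  (\forall n \near \oo, Rintegral (rho n) setT (ramp a b) <= c) -> L a b <= c.
Proof. by move=> ab; apply: limr_le; exact: cvg_ramp. Qed.

Lemma ramp_lim_ge (a b c : R) : a < b ->
  (\forall n \near \oo, c <= Rintegral (rho n) setT (ramp a b)) -> c <= L a b.
Proof. by move=> ab; apply: limr_ge; exact: cvg_ramp. Qed.

Lemma ramp_lim_leD (a b a' b' c : R) : a < b -> a' < b' ->
  (forall t, ramp a b t <= ramp a' b' t + c) -> L a b <= L a' b' + c.
Proof.
move=> ab ab' h.
have H1 : (fun n => Rintegral (rho n) setT (ramp a b)) @ \oo --> L a b.
  exact: cvg_ramp.
have H2 : (fun n => Rintegral (rho n) setT (ramp a' b') + c) @ \oo --> L a' b' + c.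
  by apply: cvgD; [exact: cvg_ramp|exact: cvg_cst].
apply: (ler_cvg_to H1 H2).
apply: nearW => n; rewrite -[in leRHS](int_cst (rho n) c) -intD; last exact: bmf_cst.
  apply: le_int => //; first exact: bmf_ramp.
  by apply: bmfD; [exact: bmf_ramp|exact: bmf_cst].
exact: bmf_ramp.
Qed.

Lemma ramp_lim_ge0 (a b : R) : a < b -> 0 <= L a b.
Proof.
move=> ab; apply: ramp_lim_ge => //; apply: nearW => n.
by apply: Rintegral_ge0 => t _; exact: ramp_ge0.
Qed.

Lemma ramp_lim_le1 (a b : R) : a < b -> L a b <= 1.
Proof.
move=> ab; apply: ramp_lim_le => //; apply: nearW => n.
rewrite -(int_cst (rho n) 1); apply: le_int; [exact: bmf_ramp|exact: bmf_cst|].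
by move=> t; exact: ramp_le1.
Qed.

Lemma ramp_lim_mono (a b a' b' : R) : a < b -> a' < b' -> b <= a' -> L a b <= L a' b'.
Proof.
move=> ab ab' ba; rewrite -[leRHS]addr0; apply: ramp_lim_leD => // t.
by rewrite addr0; exact: ramp_mono.
Qed.

(** A ramp of width d is 1/d-Lipschitz, so translating it by c costs at most |c|/d uniformly; right
    continuity of the limit function rests on this. *)
Lemma ramp_lim_shift (x d c : R) : 0 < d -> L (x + c) (x + c + d) <= L x (x + d) + `|c| / d.
Proof.
move=> d0; apply: ramp_lim_leD => [||t]; rewrite ?ltrDl//.
have -> : x + c + d = x + d + c by ring.
rewrite ramp_shift.
have xd : x < x + d by rewrite ltrDl.
have := ramp_lip (t - c) t xd; rewrite addrAC subrr sub0r normrN.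
rewrite (_ : x + d - x = d); last by ring.
by rewrite ler_norml; lra.
Qed.

Lemma ramp_lim_top (e : R) : 0 < e -> exists x0, forall x, x0 <= x -> 1 - e <= L x (x + 1).
Proof.
move=> e0; have e20 : 0 < e / 2 by rewrite divr_gt0.
have [Y Y0 HY] := tight e20; exists Y => x Yx.
have x1 : x < x + 1 by rewrite ltrDl.
apply: ramp_lim_ge => //; move: HY; apply: filterS => n hn.
have bt : bmf (fun t => 2 * tail Y t) by apply: bmfZ; exact: bmf_tail.
apply: (@le_trans _ _ (Rintegral (rho n) setT (fun t => 1 - 2 * tail Y t))).
  rewrite intB//; last exact: bmf_cst.
  by rewrite int_cst intZ; [lra|exact: bmf_tail].
apply: le_int; [by apply: bmfB => //; exact: bmf_cst|exact: bmf_ramp|move=> t].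
have [xt|tx] := leP t x.
  by rewrite ramp_eq1//; have := tail_ge0 t Y0; lra.
have : Y <= `|t| by apply: le_trans (ler_norm _); lra.
by move=> /(tail_ge_half Y0); have := ramp_ge0 x (x + 1) t; lra.
Qed.

Lemma ramp_lim_bot (e : R) : 0 < e -> exists x0, forall x, x <= x0 -> L x (x + 1) <= e.
Proof.
move=> e0; have e20 : 0 < e / 2 by rewrite divr_gt0.
have [Y Y0 HY] := tight e20; exists (- Y - 1) => x Yx.
have x1 : x < x + 1 by rewrite ltrDl.
apply: ramp_lim_le => //; move: HY; apply: filterS => n hn.
have bt : bmf (fun t => 2 * tail Y t) by apply: bmfZ; exact: bmf_tail.
apply: (@le_trans _ _ (Rintegral (rho n) setT (fun t => 2 * tail Y t))); last first.
  by rewrite intZ; [lra|exact: bmf_tail].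
apply: le_int => //; [exact: bmf_ramp|move=> t].
have [xt|tx] := leP (x + 1) t.
  by rewrite ramp_eq0//; have := tail_ge0 t Y0; lra.
have : Y <= `|t| by rewrite -normrN; apply: le_trans (ler_norm _); lra.
by move=> /(tail_ge_half Y0); have := ramp_le1 x (x + 1) t; lra.
Qed.

(** The ramps from x to x + d dominate the indicator of ]-oo, x] and decrease to it as d tends to 0,
    so the infimum selects the right-continuous version at jumps. *)
Definition limit_cdf (x : R) : R := inf [set L x (x + d) | d in [set d | 0 < d]].

Local Notation F := limit_cdf.

Lemma limit_cdf_le (x d : R) : 0 < d -> F x <= L x (x + d).
Proof.
move=> d0; apply: ge_inf; last by exists d.
by exists 0 => _ [d' /= d'0 <-]; apply: ramp_lim_ge0; rewrite ltrDl.
Qed.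

Lemma limit_cdf_ge (c x : R) : (forall d, 0 < d -> c <= L x (x + d)) -> c <= F x.
Proof.
move=> h; apply: lb_le_inf; first by exists (L x (x + 1)); exists 1 => //=.
by move=> _ [d /= d0 <-]; exact: h.
Qed.

Lemma limit_cdf_ramp (a b : R) : a < b -> F a <= L a b <= F b.
Proof.
move=> ab; apply/andP; split.
  have := @limit_cdf_le a (b - a); rewrite subr_gt0 => /(_ ab).
  by rewrite addrC subrK.
by apply: limit_cdf_ge => d d0; apply: ramp_lim_mono; rewrite ?ltrDl.
Qed.

Lemma limit_cdf_itv (x : R) : 0 <= F x <= 1.
Proof.
apply/andP; split; first by apply: limit_cdf_ge => d d0; apply: ramp_lim_ge0; rewrite ltrDl.
by apply: le_trans (limit_cdf_le x ltr01) _; apply: ramp_lim_le1; rewrite ltrDl.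
Qed.

Lemma limit_cdf_nd : nondecreasing F.
Proof.
move=> x y; rewrite le_eqVlt => /predU1P[->//|xy].
by have /andP[h1 h2] := limit_cdf_ramp xy; exact: le_trans h2.
Qed.

Lemma limit_cdf_rc : right_continuous F.
Proof.
move=> x; apply/cvgrPdist_le => e e0; have e20 : 0 < e / 2 by rewrite divr_gt0.
have [d d0 Hd] : exists2 d, 0 < d & L x (x + d) < F x + e / 2.
  have [|_ [d /= d0 <-] Hd] := @inf_adherent R [set L x (x + d) | d in [set d | 0 < d]] _ e20.
    split; first by exists (L x (x + 1)); exists 1 => //=.
    by exists 0 => _ [d' /= d'0 <-]; apply: ramp_lim_ge0; rewrite ltrDl.
  by exists d.
near=> y.
have xy : x < y by near: y; exact: nbhs_right_gt.
(* Then F y <= L y (y + d) <= L x (x + d) + e/2 < F x + e. *)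
have yx : y - x <= d * (e / 2).
  rewrite lerBlDl; near: y; apply: nbhs_right_le; rewrite ltrDl mulr_gt0//.
rewrite ler0_norm ?subr_le0; last by apply: limit_cdf_nd; exact: ltW.
have := limit_cdf_le y d0; have := ramp_lim_shift x (y - x) d0.
rewrite (_ : x + (y - x) = y); last by ring.
have : `|y - x| / d <= e / 2.
  by rewrite ler_pdivrMr// gtr0_norm ?subr_gt0// mulrC.
move: Hd.
move: (F x) (F y) (L x _) (L y _) (`|y - x| / d) => u v p q r h1 h2 h3 h4.
by clear -h1 h2 h3 h4; lra.
Unshelve. all: by end_near. Qed.

Lemma limit_cdf_y : F @ +oo --> (1 : R).
Proof.
apply/cvgrPdist_le => e /ramp_lim_top[x0 H]; near=> x.
have /andP[F0 F1] := limit_cdf_itv x.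
rewrite ger0_norm ?subr_ge0//.
have x1 : x - 1 < x by lra.
have /andP[_] := limit_cdf_ramp x1.
have := H (x - 1); rewrite subrK => h.
have : x0 <= x - 1 by rewrite lerBrDr; near: x; apply: nbhs_pinfty_ge; rewrite num_real.
by move=> /h; lra.
Unshelve. all: by end_near. Qed.

Lemma limit_cdf_Ny : F @ -oo --> (0 : R).
Proof.
apply/cvgrPdist_le => e /ramp_lim_bot[x0 H]; near=> x.
have /andP[F0 F1] := limit_cdf_itv x.
rewrite sub0r normrN ger0_norm//.
apply: le_trans (limit_cdf_le x ltr01) _; apply: H.
by near: x; apply: nbhs_ninfty_le; rewrite num_real.
Unshelve. all: by end_near. Qed.

End LimitCdf.

(** * Weak convergence *)

(** Only [x] is confined to the segment. Compactness is used in its covering form, with the local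
    radius halved to leave room for moving both the centre and [t]. *)
Lemma segment_unif_continuous (R : realType) (f : R -> R) (a b e : R) :
  continuous f -> 0 < e ->
  exists2 d, 0 < d & forall x t, a <= x <= b -> `|x - t| <= d -> `|f x - f t| <= e.
Proof.
move=> cf e0.
have /compact_near_coveringP H := @segment_compact R a b.
have : \forall d \near (0:R)^'+, `[a, b]%classic `<=`
    (fun x => forall t, `|x - t| <= d -> `|f x - f t| <= e).
  apply: H => x _.
  have e20 : 0 < e / 2 by rewrite divr_gt0.
  have /cvgrPdist_le /(_ _ e20) := cf x.
  move=> /nbhs_ballP[r /= r0 Hr].
  have r20 : 0 < r / 2 by rewrite divr_gt0.
  exists (ball x (r / 2), [set d : R | d < r / 2]) => /=.
    by split; [exact: nbhsx_ballx|exact: nbhs_right_lt].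
  move=> [x' d] [/= xx' dr] t x't.
  have h1 : `|f x - f x'| <= e / 2.
    by apply: Hr; rewrite /ball /= in xx' *; lra.
  have h2 : `|f x - f t| <= e / 2.
    apply: Hr; rewrite /ball /= in xx' *.
    by apply: le_lt_trans (ler_distD x' _ _) _; lra.
  by apply: le_trans (ler_distD (f x) _ _) _; rewrite (distrC (f x')); lra.
move=> near0.
have [d [d0 Hd]] := @filter_ex _ (0:R)^'+ _ _ (filterI (nbhs_right_gt 0) near0).
by exists d => // x t abx; apply: Hd; rewrite /= in_itv.
Qed.

Section PiecewiseLinear.
Variables (R : realType) (f : R -> R) (x0 d : R).
Hypothesis d0 : 0 < d.

Definition grid (i : nat) : R := x0 + d *+ i.

Lemma gridS i : grid i.+1 = grid i + d.
Proof. by rewrite /grid mulrSr addrA. Qed.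

Lemma grid_lt i : grid i < grid i.+1.
Proof. by rewrite gridS ltrDl. Qed.

Lemma le_grid i j : (i <= j)%N -> grid i <= grid j.
Proof.
by move=> ij; rewrite /grid lerD2l -(mulr_natr d i) -(mulr_natr d j) ler_wpM2l ?(ltW d0)// ler_nat.
Qed.

(** Piecewise linear interpolation of f at the grid points, constant beyond them; the i-th ramp
    switches from the value at its right end to the value at its left end. *)
Definition pwl (K : nat) (t : R) : R :=
  f (grid K) + \sum_(i < K) (f (grid i) - f (grid i.+1)) * ramp (grid i) (grid i.+1) t.

Lemma pwlS K t : pwl K.+1 t = pwl K t - f (grid K) + f (grid K.+1) +
  (f (grid K) - f (grid K.+1)) * ramp (grid K) (grid K.+1) t.
Proof. by rewrite /pwl big_ord_recr /=; ring. Qed.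

Lemma pwl_right K t : grid K <= t -> pwl K t = f (grid K).
Proof.
elim: K => [|K IH] Kt; first by rewrite /pwl big_ord0 addr0.
rewrite pwlS IH; last by apply: le_trans Kt; exact: ltW (grid_lt K).
by rewrite ramp_eq0 ?grid_lt//; ring.
Qed.

Lemma pwl_left K t : t <= grid 0 -> pwl K t = f (grid 0).
Proof.
move=> t0; elim: K => [|K IH]; first by rewrite /pwl big_ord0 addr0.
by rewrite pwlS IH ramp_eq1 ?grid_lt ?(le_trans t0 (le_grid (leq0n K)))//; ring.
Qed.

Lemma pwl_near K t (e : R) : 0 <= e -> grid 0 <= t <= grid K ->
  (forall i t, (i < K)%N -> grid i <= t <= grid i.+1 ->
     `|f (grid i) - f t| <= e /\ `|f (grid i.+1) - f t| <= e) ->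
  `|pwl K t - f t| <= e.
Proof.
move=> e0; elim: K => [|K IH] /andP[t0 tK] h.
  have -> : t = grid 0 by apply/eqP; rewrite eq_le tK.
  by rewrite pwl_right// subrr normr0.
have [tK'|Kt] := leP t (grid K).
  rewrite pwlS (ramp_eq1 (grid_lt K) tK').
  rewrite (_ : pwl K t - _ + _ + _ = pwl K t); last by ring.
  by apply: IH => [|i u iK]; [rewrite t0|apply: h; exact: ltnW].
rewrite pwlS pwl_right ?(ltW Kt)//.
have [|h1 h2] := h K t (ltnSn K); first by rewrite (ltW Kt).
have r0 := ramp_ge0 (grid K) (grid K.+1) t; have r1 := ramp_le1 (grid K) (grid K.+1) t.
move: (ramp _ _ _) r0 r1 h1 h2 => r r0 r1 h1 h2.
(* On its last interval the interpolant is a convex combination of the two end values, with weight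
   r. *)
rewrite (_ : f (grid K) - f (grid K) + f (grid K.+1) + (f (grid K) - f (grid K.+1)) * r - f t =
  r * (f (grid K) - f t) + (1 - r) * (f (grid K.+1) - f t)); last by ring.
apply: le_trans (ler_normD _ _) _; rewrite !normrM (ger0_norm r0) (@ger0_norm _ (1 - r)) ?subr_ge0//.
rewrite [leRHS](_ : e = r * e + (1 - r) * e); last by ring.
by apply: lerD; apply: ler_wpM2l => //; rewrite subr_ge0.
Qed.

Lemma bmf_sum K (g : nat -> R -> R) : (forall i, bmf (g i)) ->
  bmf (fun t => \sum_(i < K) g i t).
Proof.
move=> bg; elim: K => [|K IH].
  by under eq_fun do rewrite big_ord0; exact: bmf_cst.
by under eq_fun do rewrite big_ord_recr /=; exact: bmfD.
Qed.

Lemma bmf_pwl K : bmf (pwl K).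
Proof.
apply: bmfD; first exact: bmf_cst.
apply: (@bmf_sum K (fun i t => (f (grid i) - f (grid i.+1)) *
  ramp (grid i) (grid i.+1) t)) => i.
by apply: bmfZ; apply: bmf_ramp; exact: grid_lt.
Qed.

Lemma int_pwl (rho : prob R) K : Rintegral rho setT (pwl K) =
  f (grid K) + \sum_(i < K) (f (grid i) - f (grid i.+1)) *
    Rintegral rho setT (ramp (grid i) (grid i.+1)).
Proof.
elim: K => [|K IH].
  rewrite big_ord0 addr0 -[RHS](int_cst rho); congr Rintegral.
  by apply/funext => t; rewrite /pwl big_ord0 addr0.
have -> : pwl K.+1 = fun t => pwl K t + ((- f (grid K) + f (grid K.+1)) +
  (f (grid K) - f (grid K.+1)) * ramp (grid K) (grid K.+1) t).
  by apply/funext => t; rewrite pwlS; ring.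
have br : bmf (ramp (grid K) (grid K.+1)) by apply: bmf_ramp; exact: grid_lt.
have bz : bmf (fun t => (f (grid K) - f (grid K.+1)) * ramp (grid K) (grid K.+1) t).
  exact: bmfZ.
rewrite intD; [|exact: bmf_pwl|by apply: bmfD => //; exact: bmf_cst].
rewrite (intD _ (bmf_cst _) bz).
by rewrite int_cst intZ// IH big_ord_recr /=; ring.
Qed.

End PiecewiseLinear.

Section WeakLimit.
Variables (R : realType) (rho : nat -> prob R).
Hypothesis cvg_ramp : forall a b : R, a < b ->
  cvgn (fun n => Rintegral (rho n) setT (ramp a b)).
Hypothesis tight : forall e : R, 0 < e ->
  exists2 Y, 0 < Y & \forall n \near \oo, Rintegral (rho n) setT (tail Y) <= e.
Variable lam : prob R.
Local Notation F := (limit_cdf rho).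
Local Notation L := (ramp_lim rho).
Hypothesis lamE : forall x, lam `]-oo, x]%classic = (F x)%:E.

Let bmf_indic_itv (x : R) : bmf (\1_(`]-oo, x]%classic : set R) : R -> R).
Proof.
have mA : measurable (`]-oo, x]%classic : set R) by [].
split; first exact: measurable_indic mA.
by exists 1 => t; rewrite indicE; case: (t \in _); rewrite ?normr1 ?normr0.
Qed.

Let int_indic (x : R) : Rintegral lam setT (\1_(`]-oo, x]%classic : set R)) = F x.
Proof.
rewrite /Rintegral integral_indic//.
by rewrite setIT; exact: (congr1 fine (lamE x)).
Qed.

(** The ramp lies between the indicators of ]-oo, a] and ]-oo, b]. *)
Lemma int_ramp_cdf (a b : R) : a < b -> F a <= Rintegral lam setT (ramp a b) <= F b.
Proof.
move=> ab; rewrite -!int_indic; apply/andP; split.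
  apply: le_int => //; first exact: bmf_ramp.
  move=> t; rewrite indicE; have [|_] := boolP (t \in _); last exact: ramp_ge0.
  by rewrite inE /= in_itv /= => ta; rewrite ramp_eq1.
apply: le_int => //; first exact: bmf_ramp.
move=> t; rewrite indicE; have [_|] := boolP (t \in _); first exact: ramp_le1.
by rewrite notin_setE /= in_itv /= => /negP; rewrite -ltNge => /ltW bt; rewrite ramp_eq0.
Qed.

(* For each ramp, the limit and the integral against [lam] both lie between two
   consecutive values of [F], whose increments sum up to at most 1. *)
Lemma int_pwl_lim f x0 d K (e : R) : 0 < d -> 0 < e ->
  (forall i, (i < K)%N -> `|f (grid x0 d i) - f (grid x0 d i.+1)| <= e) ->
  \forall n \near \oo,
    `|Rintegral (rho n) setT (pwl f x0 d K) - Rintegral lam setT (pwl f x0 d K)| <= e + e.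
Proof.
move=> d0 e0 fe.
pose c i := f (grid x0 d i) - f (grid x0 d i.+1).
pose P := f (grid x0 d K) + \sum_(i < K) c i * L (grid x0 d i) (grid x0 d i.+1).
have gl i := grid_lt x0 d0 i.
have HP : (fun n => Rintegral (rho n) setT (pwl f x0 d K)) @ \oo --> P.
  under eq_fun do rewrite int_pwl//.
  apply: cvgD; first exact: cvg_cst.
  apply: cvg_big => [|i _]; first exact: add_continuous.
  by apply: cvgM; [exact: cvg_cst|exact: cvg_ramp].
have Plam : `|P - Rintegral lam setT (pwl f x0 d K)| <= e.
  rewrite int_pwl// /P opprD addrACA subrr add0r -sumrB.
  apply: (@le_trans _ _ (\sum_(i < K) e * (F (grid x0 d i.+1) - F (grid x0 d i)))).
    apply: le_trans (ler_norm_sum _ _ _) _; apply: ler_sum => i _.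
    rewrite -/(c i) -mulrBr normrM ler_pM//; first exact: fe.
    have /andP[h1 h2] := int_ramp_cdf (gl i).
    have /andP[h3 h4] := limit_cdf_ramp cvg_ramp (gl i).
    move: (F _) (F _) (L _ _) (Rintegral _ _ _) h1 h2 h3 h4 => u v w z h1 h2 h3 h4.
    by rewrite ler_norml; lra.
  rewrite -mulr_sumr -(big_mkord xpredT (fun i => F (grid x0 d i.+1) - F (grid x0 d i))).
  rewrite telescope_sumr// -[leRHS]mulr1 ler_wpM2l// ?(ltW e0)//.
  have /andP[h1 _] := limit_cdf_itv cvg_ramp (grid x0 d 0).
  have /andP[_ h2] := limit_cdf_itv cvg_ramp (grid x0 d K).
  move: (F _) (F _) h1 h2 => u v h1 h2.
  by lra.
move/cvgrPdist_le: HP => /(_ e e0); apply: filterS => n hn.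
apply: le_trans (ler_distD P _ _) _; rewrite distrC.
by rewrite lerD.
Qed.

Lemma weak_cvg_of_ramps : weak_cvg rho lam.
Proof.
move=> f cf [B fB].
have B0 : 0 <= B := le_trans (normr_ge0 _) (fB 0).
have bf := bmf_continuous cf fB.
apply/cvgrPdist_le => e e0.
pose e' := e / 8; have e'0 : 0 < e' by rewrite divr_gt0.
(* The interpolation errors add up to 4 e' = e/2 and the two tail errors to 8 B tau, at most e/2; B
   + 1 allows for B = 0. *)
pose tau := e / (16 * (B + 1)).
have B1 : 0 < 16 * (B + 1) by lra.
have tau0 : 0 < tau by rewrite divr_gt0.
have Btau : 8 * (B * tau) <= e / 2.
  rewrite (_ : e / 2 = 8 * ((B + 1) * tau)); last by rewrite /tau; field; rewrite gt_eqF//; lra.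
  by rewrite ler_pM2l// ler_wpM2r ?(ltW tau0)// lerDl.
have [Y1 Y10 HY1] := tight tau0.
have [Y2 Y20 /(_ _ (lexx _)) HY2] := int_tail_cvg0 lam tau0.
pose Y := Num.max Y1 Y2.
have Y1Y : Y1 <= Y by rewrite le_max lexx.
have Y2Y : Y2 <= Y by rewrite le_max lexx orbT.
have Y0 : 0 < Y := lt_le_trans Y10 Y1Y.
have [delta delta0 Hf] := segment_unif_continuous (- Y) Y cf e'0.
(* Enough intervals for the mesh of [-Y, Y] to be at most delta. *)
pose k := (Num.bound (2 * Y / delta)).+1.
pose d := 2 * Y / k%:R.
have k0 : 0 < k%:R :> R by rewrite ltr0n.
have Y20' : 0 < 2 * Y by lra.
have d0 : 0 < d by rewrite divr_gt0.
have d_delta : d <= delta.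
  rewrite ler_pdivrMr// [leRHS]mulrC -ler_pdivrMr//.
  have : 2 * Y / delta < (Num.bound (2 * Y / delta))%:R.
    by apply: archi_boundP; rewrite divr_ge0 ?(ltW Y20') ?(ltW delta0).
  by move=> /ltW /le_trans; apply; rewrite ler_nat.
have g0 : grid (- Y) d 0 = - Y by rewrite /grid mulr0n addr0.
have gk : grid (- Y) d k = Y.
  by rewrite /grid -mulr_natr /d divfK ?gt_eqF//; ring.
have gridY i : (i <= k)%N -> - Y <= grid (- Y) d i <= Y.
  by move=> ik; apply/andP; split; [rewrite -[leLHS]g0|rewrite -[leRHS]gk]; exact: le_grid.
have close i t : (i < k)%N -> grid (- Y) d i <= t <= grid (- Y) d i.+1 ->
    `|f (grid (- Y) d i) - f t| <= e' /\ `|f (grid (- Y) d i.+1) - f t| <= e'.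
  move=> ik /andP[it ti]; have gi := gridY i (ltnW ik); have gi1 := gridY i.+1 ik.
  rewrite gridS in ti; split; apply: Hf => //.
    by rewrite ler_norml; lra.
  by rewrite gridS ler_norml; lra.
pose p := pwl f (- Y) d k.
have bp : bmf p by exact: bmf_pwl.
(* [Z] is left free since the sequence and [lam] have different tail thresholds, while the
   interpolant is built on one interval. Outside it the error 2 B is absorbed by [tail], which is at
   least 1/2 there. *)
have fp Z t : 0 < Z -> Z <= Y -> `|f t - p t| <= e' + 4 * B * tail Z t.
  move=> Z0 ZY; have t0 := tail_ge0 t Z0.
  have out u : `|f t - f u| <= 2 * B.
    by apply: le_trans (ler_normB _ _) _; have := fB t; have := fB u; lra.
  have far : Y <= `|t| -> 2 * B <= e' + 4 * B * tail Z t.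
    move=> Yt; have h := tail_ge_half Z0 (le_trans ZY Yt).
    have : 2 * B * 1 <= 2 * B * (2 * tail Z t) by rewrite ler_wpM2l// mulr_ge0.
    by lra.
  have [tY|Yt] := leP t (- Y).
    rewrite /p pwl_left ?g0//; apply: le_trans (out _) (far _).
    by rewrite -normrN; apply: le_trans (ler_norm _); lra.
  have [tY|Yt'] := leP t Y; last first.
    rewrite /p pwl_right ?gk ?(ltW Yt')//; apply: le_trans (out _) (far _).
    by apply: le_trans (ler_norm _); exact: ltW.
  apply: (@le_trans _ _ e'); last by rewrite lerDl mulr_ge0// mulr_ge0.
  rewrite distrC; apply: pwl_near => //; first exact: ltW.
  by rewrite g0 gk (ltW Yt).
have int_fp (sigma : prob R) Z : 0 < Z -> Z <= Y ->
    Rintegral sigma setT (tail Z) <= tau ->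
    `|Rintegral sigma setT f - Rintegral sigma setT p| <= e' + 4 * (B * tau).
  move=> Z0 ZY hZ; have bt : bmf (tail Z) := bmf_tail Z0.
  have bt4 : bmf (fun t => 4 * B * tail Z t) by exact: bmfZ.
  have bs : bmf (fun t => e' + 4 * B * tail Z t) by apply: bmfD => //; exact: bmf_cst.
  apply: (le_trans (norm_intB sigma bf bp bs (fun t => fp Z t Z0 ZY))).
  rewrite intD//; last exact: bmf_cst.
  rewrite int_cst intZ// lerD2l -mulrA ler_pM2l// ler_wpM2l//.
have hlam := int_fp lam Y2 Y20 Y2Y HY2.
have cl i : (i < k)%N -> `|f (grid (- Y) d i) - f (grid (- Y) d i.+1)| <= e'.
  move=> ik; have [|h _] := close i (grid (- Y) d i.+1) ik; last exact: h.
  by rewrite lexx andbT ltW// grid_lt.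
move: HY1 (@int_pwl_lim f (- Y) d k e' d0 e'0 cl); apply: filterS2 => n hn h2.
have h1 := int_fp (rho n) Y1 Y10 Y1Y hn.
rewrite -/p in h2.
have -> : Rintegral lam setT f - Rintegral (rho n) setT f =
  (Rintegral lam setT f - Rintegral lam setT p) -
  ((Rintegral (rho n) setT p - Rintegral lam setT p) +
   (Rintegral (rho n) setT f - Rintegral (rho n) setT p)) by ring.
apply: le_trans (ler_normB _ _) _.
have := ler_normD (Rintegral (rho n) setT p - Rintegral lam setT p)
  (Rintegral (rho n) setT f - Rintegral (rho n) setT p).
move: hlam h1 h2 Btau; rewrite /e'.
move: (`|_|) (`|_|) (`|_|) (`|_|) (B * tau) => u v w x y.
by lra.
Qed.

End WeakLimit.

(** * Convolutions along sequences of graphs *)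

Section GraphSequences.
Variable R : realType.

(** The vertex type is packed with its relation so that sequences over different vertex types can be
    interleaved. *)
Definition graph := {T : finType & rel T}.

Definition admissible (G : nat -> graph) (m bp conv : nat -> prob R) (mu : prob R) :=
  [/\ \forall n \near \oo, (0 < #|tag (G n)|)%N,
      forall n, is_boolean_power (m n) #|tag (G n)| (bp n),
      weak_cvg bp mu &
      forall n, is_Gfree_conv (tagged (G n)) (fun _ => m n) (conv n)].

Lemma admissible_limit G m bp conv mu : admissible G m bp conv mu ->
  (forall t, exists l : R,
     (fun n => hom_density R (@gedge t) (tagged (G n))) @ \oo --> l) ->
  exists lam, weak_cvg conv lam.
Proof.
move=> [G0 bpE bp_cvg /= convE] dens.
pose nu n := projT1 (cid (convE n)).
have nuE n v z : upper z -> Ktrans (nu n v) z =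
    Ktrans (m n) (z - \sum_(w | tagged (G n) v w) Ktrans (nu n w) z).
  by rewrite /nu; case: cid => /= f [h _]; exact: h.
have cE n z : upper z -> Ktrans (conv n) z = \sum_v Ktrans (nu n v) z.
  by rewrite /nu; case: cid => /= f [_ h]; exact: h.
have small := Ktrans_conv_small G0 bpE bp_cvg nuE cE.
have e40 : 0 < 1 / 4 :> R by lra.
have [M1 M10 HM1] := small _ e40.
have [M2 M20 HM2] := Ktrans_conv_cvg G0 dens bpE bp_cvg nuE cE.
pose M := Num.max 1 (Num.max M1 M2).
have M_1 : 1 <= M by rewrite le_max lexx.
have M1M : M1 <= M by rewrite !le_max lexx orbT.
have M2M : M2 <= M by rewrite !le_max lexx !orbT.
have res_cvg : forall a i, M ^+ 2 <= a ->
    cvgn (fun n => Rintegral (conv n) setT (res a i)).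
  apply: cvgn_res => //.
    by move=> y My; apply: HM2; exact: le_trans My.
  by move: HM1; apply: filterS => n h y My; apply: h; exact: le_trans My.
have tight e : 0 < e ->
    exists2 Y, 0 < Y & \forall n \near \oo, Rintegral (conv n) setT (tail Y) <= e.
  move=> e0; pose eps := Num.min (e / 2) (1 / 2).
  have eps0 : 0 < eps by rewrite lt_min; apply/andP; split; lra.
  have eps1 : eps <= 1 / 2 by rewrite ge_min lexx orbT.
  have eps2 : eps <= e / 2 by rewrite ge_min lexx.
  have [Y Y0 HY] := small _ eps0.
  pose Z := Num.max 1 Y.
  have Z1 : 1 <= Z by rewrite le_max lexx.
  have YZ : Y <= Z by rewrite le_max lexx orbT.
  exists Z; first exact: lt_le_trans Z1.
  move: HY; apply: filterS => n /(_ Z YZ) h.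
  by apply: le_trans (int_tail_Ktrans Z1 eps1 h) _; lra.
have M21 : 1 <= M ^+ 2 by rewrite expr_ge1// (le_trans ler01).
have cr a b : a < b -> cvgn (fun n => Rintegral (conv n) setT (ramp a b)).
  exact: cvgn_ramp M21 res_cvg tight a b.
have [lam lamE] := prob_of_cdf (limit_cdf_nd cr) (limit_cdf_rc cr)
  (limit_cdf_Ny cr tight) (limit_cdf_y cr tight).
by exists lam; exact: weak_cvg_of_ramps lamE.
Qed.

Definition interleave (T : Type) (u v : nat -> T) (n : nat) : T :=
  if odd n then v n./2 else u n./2.

Lemma near_interleave (P Q : nat -> Prop) :
  (\forall n \near \oo, P n) -> (\forall n \near \oo, Q n) ->
  \forall n \near \oo, if odd n then Q n./2 else P n./2.
Proof.
move=> [N1 _ H1] [N2 _ H2]; exists (maxn N1 N2).*2 => // n /= Nn.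
have h : (maxn N1 N2 <= n./2)%N by rewrite -leq_double; lia.
by case: (odd n); [apply: H2 => /=|apply: H1 => /=]; lia.
Qed.

Lemma cvg_interleave (u v : nat -> R) (l : R) :
  u @ \oo --> l -> v @ \oo --> l -> interleave u v @ \oo --> l.
Proof.
move=> /cvgrPdist_le Hu /cvgrPdist_le Hv; apply/cvgrPdist_le => e e0.
move: (near_interleave (Hu e e0) (Hv e e0)); apply: filterS => n.
by rewrite /interleave; case: (odd n).
Qed.

Lemma cvg_deinterleave (u v : nat -> R) (l : R) :
  interleave u v @ \oo --> l -> u @ \oo --> l /\ v @ \oo --> l.
Proof.
move=> /cvgrPdist_le H; split; apply/cvgrPdist_le => e /H[N _ HN].
  exists N => // n /= Nn; have := HN n.*2; rewrite /interleave odd_double doubleK.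
  by apply => /=; lia.
exists N => // n /= Nn; have := HN n.*2.+1.
rewrite /interleave /= odd_double /= uphalf_double.
by apply => /=; lia.
Qed.

Lemma weak_cvg_interleave (u v : nat -> prob R) lam :
  weak_cvg u lam -> weak_cvg v lam -> weak_cvg (interleave u v) lam.
Proof.
move=> hu hv f cf bf; have := cvg_interleave (hu f cf bf) (hv f cf bf).
apply: cvg_trans; apply: near_eq_cvg; apply: nearW => n.
by rewrite /interleave; case: (odd n).
Qed.

Lemma weak_cvg_deinterleave (u v : nat -> prob R) lam :
  weak_cvg (interleave u v) lam -> weak_cvg u lam /\ weak_cvg v lam.
Proof.
move=> h; have H f : continuous f -> (exists M : R, forall x, `|f x| <= M) ->
  interleave (fun n => Rintegral (u n) setT f) (fun n => Rintegral (v n) setT f)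
    @ \oo --> Rintegral lam setT f.
  move=> cf bf; have := h f cf bf.
  apply: cvg_trans; apply: near_eq_cvg; apply: nearW => n.
  by rewrite /interleave; case: (odd n).
by split=> f cf bf; have [] := cvg_deinterleave (H f cf bf).
Qed.

(** The measures [lam] and [lam'] are not identified; equality of their integrals of bounded
    continuous functions is enough. *)
Lemma weak_cvg_transfer (u v : nat -> prob R) lam lam' :
  weak_cvg u lam -> weak_cvg u lam' -> weak_cvg v lam' -> weak_cvg v lam.
Proof.
move=> h1 h2 h3 f cf bf.
have -> : Rintegral lam setT f = Rintegral lam' setT f.
  exact: (cvg_unique _ (h1 f cf bf) (h2 f cf bf)).
exact: h3.
Qed.

Lemma admissible_interleave G G' m m' bp bp' conv conv' mu :
  admissible G m bp conv mu -> admissible G' m' bp' conv' mu ->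
  admissible (interleave G G') (interleave m m') (interleave bp bp')
    (interleave conv conv') mu.
Proof.
move=> [G0 bpE bp_cvg cE] [G0' bpE' bp_cvg' cE']; split.
- move: (near_interleave G0 G0'); apply: filterS => n.
  by rewrite /interleave; case: (odd n).
- by move=> n; rewrite /interleave; case: (odd n).
- exact: weak_cvg_interleave.
- by move=> n; rewrite /interleave; case: (odd n).
Qed.

Definition same_densities (G G' : nat -> graph) := forall t, exists l : R,
  (fun n => hom_density R (@gedge t) (tagged (G n))) @ \oo --> l /\
  (fun n => hom_density R (@gedge t) (tagged (G' n))) @ \oo --> l.

Lemma same_densities_refl G G' : same_densities G G' -> same_densities G G.
Proof. by move=> h t; have [l [h1 _]] := h t; exists l. Qed.

Lemma same_densities_sym G G' : same_densities G G' -> same_densities G' G.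
Proof. by move=> h t; have [l [h1 h2]] := h t; exists l. Qed.

Lemma admissible_common_limit G G' m m' bp bp' conv conv' mu :
  same_densities G G' ->
  admissible G m bp conv mu -> admissible G' m' bp' conv' mu ->
  exists lam, weak_cvg conv lam /\ weak_cvg conv' lam.
Proof.
move=> dens h h'.
have [|lam Hlam] := admissible_limit (admissible_interleave h h').
  move=> t; have [l [h1 h2]] := dens t; exists l.
  have := cvg_interleave h1 h2.
  apply: cvg_trans; apply: near_eq_cvg; apply: nearW => n.
  by rewrite /interleave; case: (odd n).
by exists lam; exact: weak_cvg_deinterleave.
Qed.

(** The limit has to be fixed before the convolutions are given. It is taken from the reference
    [conv0]; comparing any [conv] with it, also for the same graphs, again goes by interleaving. *)
Lemma admissible_limits G G' m m' bp bp' conv0 mu :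
  same_densities G G' -> admissible G m bp conv0 mu ->
  exists lam,
    (forall conv, admissible G m bp conv mu -> weak_cvg conv lam) /\
    (forall conv, admissible G' m' bp' conv mu -> weak_cvg conv lam).
Proof.
move=> dens h0; have dens1 := same_densities_refl dens.
have [lam [h _]] := admissible_common_limit dens1 h0 h0.
exists lam; split=> conv hc.
  have [lam' [h1 h2]] := admissible_common_limit dens1 h0 hc.
  exact: weak_cvg_transfer h h1 h2.
have [lam' [h1 h2]] := admissible_common_limit dens h0 hc.
exact: weak_cvg_transfer h h1 h2.
Qed.

End GraphSequences.

(* Two pairs (G_n, mu_n) and (G~_n, mu~_n) satisfying the hypotheses with the
   same mu and the same coefficients beta_{G'}; the conclusion gives a common
   weak limit of the G_n-free and G~_n-free convolutions.  Taking the second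
   pair equal to the first gives the existence part. *)
Theorem theorem1p1 (R : realType)
  (V : nat -> finType) (E : forall n, rel (V n)) (mus : nat -> prob R)
  (W : nat -> finType) (F : forall n, rel (W n)) (nus : nat -> prob R)
  (mu : prob R) :
  (forall n, digraph (E n)) ->
  (forall n, digraph (F n)) ->
  (forall M : nat, \forall n \near \oo, (M <= #|V n|)%N) ->
  (forall M : nat, \forall n \near \oo, (M <= #|W n|)%N) ->
  (forall (T : finType) (e : rel T) (r : T), rooted_tree e r ->
     exists beta : R,
       (fun n => hom_density R e (E n)) @ \oo --> beta /\
       (fun n => hom_density R e (F n)) @ \oo --> beta) ->
  (exists bp : nat -> prob R,
     (forall n, is_boolean_power (mus n) #|V n| (bp n)) /\ weak_cvg bp mu) ->
  (exists bp : nat -> prob R,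
     (forall n, is_boolean_power (nus n) #|W n| (bp n)) /\ weak_cvg bp mu) ->
  exists lam : prob R,
    (forall conv : nat -> prob R,
       (forall n, is_Gfree_conv (E n) (fun _ => mus n) (conv n)) ->
       weak_cvg conv lam) /\
    (forall conv : nat -> prob R,
       (forall n, is_Gfree_conv (F n) (fun _ => nus n) (conv n)) ->
       weak_cvg conv lam).
Proof.
move=> _ _ V_oo W_oo dens [bp [bpE bp_cvg]] [bp' [bpE' bp_cvg']].
pose G n : graph := Tagged (fun T : finType => rel T) (@E n).
pose G' n : graph := Tagged (fun T : finType => rel T) (@F n).
have sd : same_densities R G G'.
  by move=> t; exact: dens (rooted_tree_gtree t).
have adm conv : (forall n, is_Gfree_conv (@E n) (fun _ => mus n) (conv n)) ->
    admissible G mus bp conv mu.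
  by move=> h; split=> //; exact: V_oo 1%N.
have adm' conv : (forall n, is_Gfree_conv (@F n) (fun _ => nus n) (conv n)) ->
    admissible G' nus bp' conv mu.
  by move=> h; split=> //; exact: W_oo 1%N.
(* The limit is built from an actual sequence of convolutions, so the existence of one, for either
   family, is decided classically. If there is none, both conclusions are vacuous and any measure
   serves. *)
have [[c hc]|noE] := pselect (exists conv : nat -> prob R,
    forall n, is_Gfree_conv (@E n) (fun _ => mus n) (conv n)).
  have [lam [h h']] := admissible_limits nus bp' sd (adm c hc).
  by exists lam; split=> conv hconv; [apply: h; exact: adm|apply: h'; exact: adm'].
have [[c hc]|noF] := pselect (exists conv : nat -> prob R,
    forall n, is_Gfree_conv (@F n) (fun _ => nus n) (conv n)).
  have [lam [h' h]] := admissible_limits mus bp (same_densities_sym sd) (adm' c hc).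
  by exists lam; split=> conv hconv; [apply: h; exact: adm|apply: h'; exact: adm'].
by exists mu; split=> conv hconv; [case: noE|case: noF]; exists conv.
Qed.
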